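(* Let $d\ge 2$. Then there is $p_c(d)\in[0,1)$ such that for every $p\in(p_c(d),1)$ there is no quasilocal specification $\gamma'$ for the measure $\mu'_p=\mu_p\circ T^{-1}$, the image of the i.i.d. Bernoulli field $\mu_p$ on $\mathbb{Z}^d$ under the projection $T$ to the non-isolates.
   Context: Let $\Omega=\{0,1\}^{\mathbb{Z}^d}$ with the product topology and product $\sigma$-algebra. For $p\in[0,1]$, $\mu_p$ is the i.i.d. Bernoulli product measure on $\Omega$ with $\mu_p(\omega_x=1)=p$. For $x\in\mathbb{Z}^d$, $\partial x$ denotes the set of the $2d$ nearest neighbours of $x$. The map $T:\Omega\to\Omega$ (projection to the non-isolates) is $$(T\omega)_x=\omega_x\Bigl(1-\prod_{y\in\partial x}(1-\omega_y)\Bigr),$$ i.e. it removes all occupied sites having no occupied nearest neighbour. Put $\Omega'=T(\Omega)$, equipped with the (subspace) product topology, and $\mu'_p=\mu_p\circ T^{-1}$, a probability measure supported on $\Omega'$. Notation: $\Lambda\Subset\mathbb{Z}^d$ means that $\Lambda$ is a finite subset; $\Lambda^c=\mathbb{Z}^d\setminus\Lambda$; $\omega_\Lambda$ is the restriction of $\omega$ to $\Lambda$; $\mathcal{F}'_{\Lambda^c}$ is the $\sigma$-algebra on $\Omega'$ generated by the coordinates in $\Lambda^c$. A specification (on $\Omega'$) is a family $\gamma'=(\gamma'_\Lambda)_{\Lambda\Subset\mathbb{Z}^d}$ of probability kernels $\gamma'_\Lambda(\cdot\mid\omega')$ on $\Omega'$, $\omega'\in\Omega'$, with $\omega'\mapsto\gamma'_\Lambda(A\mid\omega')$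 being $\mathcal{F}'_{\Lambda^c}$-measurable for each measurable $A$, which is proper (under $\gamma'_\Lambda(\cdot\mid\omega')$ the configuration on $\Lambda^c$ equals $\omega'_{\Lambda^c}$ with probability one) and consistent ($\int\gamma'_\Delta(d\tilde\omega\mid\hat\omega)\,\gamma'_\Lambda(A\mid\tilde\omega)=\gamma'_\Delta(A\mid\hat\omega)$ for all $\Lambda\subset\Delta\Subset\mathbb{Z}^d$, all $\hat\omega\in\Omega'$ and all measurable $A$). It is quasilocal if for all $\Lambda\Subset\mathbb{Z}^d$ and all $\hat\omega_\Lambda\in\{0,1\}^\Lambda$ the map $\omega'\mapsto\gamma'_\Lambda(\{\sigma'\in\Omega':\sigma'_\Lambda=\hat\omega_\Lambda\}\mid\omega')$ is continuous on $\Omega'$ in the product topology. It is a specification for a probability measure $\mu'$ on $\Omega'$ if the DLR equations hold: $\int\mu'(d\tilde\omega)\,\gamma'_\Lambda(A\mid\tilde\omega)=\mu'(A)$ for all $\Lambda\Subset\mathbb{Z}^d$ and measurable $A$. *)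

(* Defs.v *)
From HB Require Import structures.
From mathcomp Require Import all_boot all_order all_algebra finmap.
From mathcomp Require Import all_classical all_reals all_analysis measurable_realfun.

Set Implicit Arguments.
Unset Strict Implicit.
Unset Printing Implicit Defensive.
Import Order.TTheory GRing.Theory Num.Theory.
Import numFieldNormedType.Exports.
Local Open Scope classical_set_scope.
Local Open Scope ring_scope.

Definition site (d : nat) := 'rV[int]_d.

Definition neighbours (d : nat) (x : site d) : seq (site d) :=
  [seq x + s *: delta_mx 0 i | i <- enum 'I_d, s <- [:: 1; -1]].

(* Events depending on a single coordinate in D; they generate the sigma-algebra
   of the coordinates in D. *)
Definition coordinate_events (d : nat) (T : Type) (c : T -> site d -> bool)
    (D : set (site d)) : set (set T) :=
  \bigcup_(x in D) preimage_set_system setT (c ^~ x) measurable.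

Definition config (d : nat) : Type := {ptws site d -> bool}.

HB.instance Definition _ d := Topological.copy (config d) {ptws site d -> bool}.
HB.instance Definition _ d :=
  isPointed.Build (config d) (fun=> false).
HB.instance Definition _ d := Measurable.copy (config d)
  (g_sigma_algebraType (@coordinate_events d (config d) id setT)).

(* Boolean form of w x * (1 - \prod_(y neighbour of x) (1 - w y)). *)
Definition thin (d : nat) (w : config d) : config d :=
  fun x => w x && ~~ \big[andb/true]_(y <- neighbours x) ~~ w y.

Definition thinned (d : nat) : Type := set_type (range (@thin d)).

Definition thinned_val (d : nat) (w : thinned d) : site d -> bool := sval w.
Coercion thinned_val : thinned >-> Funclass.

Definition to_thinned (d : nat) (w : config d) : thinned d :=
  exist _ (thin w) (mem_set (imageT (@thin d) w)).

HB.instance Definition _ d :=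
  Topological.copy (thinned d) (set_type (range (@thin d))).
HB.instance Definition _ d :=
  isPointed.Build (thinned d) (to_thinned point).
(* The trace of the product sigma-algebra on the range of thin. *)
HB.instance Definition _ d := Measurable.copy (thinned d)
  (g_sigma_algebraType (coordinate_events (@thinned_val d) setT)).

Lemma measurable_to_thinned d : measurable_fun [set: config d] (@to_thinned d).
Proof.
have mcoord (x : site d) : measurable_fun [set: config d] (fun w : config d => w x).
  move=> _ B _; rewrite setTI.
  by apply: sub_sigma_algebra; exists x => //; exists B; rewrite ?setTI.
have mthin (x : site d) : measurable_fun [set: config d] (fun w => thin w x).
  apply: measurable_and; first exact: mcoord.
  apply: measurable_neg; elim: (neighbours x) => [|y s IHs].
    rewrite [X in measurable_fun _ X](_ : _ = cst true); first exact: measurable_cst.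
    by apply/funext => w; rewrite big_nil.
  rewrite [X in measurable_fun _ X](_ : _ = fun w : config d =>
    ~~ w y && \big[andb/true]_(z <- s) ~~ w z).
    exact: (measurable_and (measurable_neg (mcoord y)) IHs).
  by apply/funext => w; rewrite big_cons.
apply: (@measurability _ _ _ _ _ _
  (coordinate_events (@thinned_val d) setT)) => //.
move=> _ [_ [x _ [B mB <-]] <-].
rewrite [X in measurable X](_ : _ = [set: config d] `&` (fun w => thin w x) @^-1` B).
  exact: mthin.
by rewrite !setTI.
Qed.

HB.instance Definition _ d :=
  isMeasurableFun.Build _ _ _ _ (@to_thinned d) (@measurable_to_thinned d).

Section specifications.
Context {R : realType} {d : nat}.
Local Open Scope ereal_scope.

(* The finite-dimensional marginals characterise the product measure. *)
Definition bernoulli_field (p : R) (mu : probability (config d) R) :=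
  forall (L : {fset site d}) (eta : {ffun L -> bool}),
    mu [set w | forall x : L, w (val x) = eta x] =
    (\prod_(x : L) bernoulli_pmf p (eta x))%:E.

(* thinned d with the sigma-algebra of the coordinates outside L: a kernel with
   this source is measurable with respect to the outside coordinates. *)
Definition thinned_outside (L : {fset site d}) :=
  g_sigma_algebraType (coordinate_events (@thinned_val d) (~` [set` L])).

Definition thinned_kernels :=
  forall L : {fset site d}, R.-pker (thinned_outside L) ~> (thinned d).

Definition proper (gamma : thinned_kernels) :=
  forall L (w : thinned d),
    gamma L w [set s : thinned d | forall x, x \notin L -> s x = w x] = 1.

Definition consistent (gamma : thinned_kernels) :=
  forall L D : {fset site d}, (L `<=` D)%fset ->
  forall (w : thinned d) (A : set (thinned d)), measurable A ->
    \int[gamma D w]_s gamma L s A = gamma D w A.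

Definition specification (gamma : thinned_kernels) :=
  proper gamma /\ consistent gamma.

Definition quasilocal (gamma : thinned_kernels) :=
  forall (L : {fset site d}) (eta : {ffun L -> bool}),
    continuous (fun w : thinned d =>
      gamma L w [set s : thinned d | forall x : L, s (val x) = eta x]).

(* The DLR equations. *)
Definition specification_for (gamma : thinned_kernels)
    (mu : probability (thinned d) R) :=
  forall (L : {fset site d}) (A : set (thinned d)), measurable A ->
    \int[mu]_s gamma L s A = mu A.

End specifications.

Section bernoulli_field_existence.
Context {R : realType} (p : R) (p01 : 0 < p < 1).

Let p_gt0 : 0 < p. Proof. by case/andP: p01. Qed.
Let p_le1 : p <= 1. Proof. by case/andP: p01 => _ /ltW. Qed.
Let q_gt0 : 0 < 1 - p. Proof. by rewrite subr_gt0; case/andP: p01. Qed.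

Let mu : {measure set (measurableTypeR R) -> \bar R} := @lebesgue_measure R.
Let I01 : set (measurableTypeR R) := `[0%R, 1%R[%classic.
Let mI01 : measurable I01. Proof. exact: measurable_itv. Qed.

Let U : {measure set (measurableTypeR R) -> \bar R} := mrestr mu mI01.
Let U_setT : U setT = 1%E.
Proof.
by rewrite /U/= /mrestr setTI /I01 /mu/= lebesgue_measure_itv/= lte_fin ltr01 oppr0 adde0.
Qed.

Let affine (a b : R) (x : measurableTypeR R) : measurableTypeR R := (x - b) / a.
Let measurable_affine (a b : R) : measurable_fun setT (affine a b).
Proof. by apply: measurable_funM => //; exact: measurable_funB. Qed.

Let mu_affine (a b : R) (A : set (measurableTypeR R)) : 0 < a -> measurable A ->
  mu (affine a b @^-1` A) = (a%:E * mu A)%E.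
Proof.
move=> a0 mA; have ai0 : 0 <= a^-1 by rewrite invr_ge0 ltW.
have <- : (a^-1%:E * mu (affine a b @^-1` A))%E = mu A.
  pose nu := mscale (NngNum ai0) (pushforward mu (affine a b)).
  apply/esym; transitivity (nu (measurable_affine a b) A) => //.
  apply: (lebesgue_measure_unique (mu := nu (measurable_affine a b))) => //= _ [[u v]] _ <-.
  rewrite /nu /mscale/= /pushforward.
  rewrite (_ : affine a b @^-1` _ = `](a * u + b), (a * v + b)]%classic).
    rewrite /mu/= !lebesgue_measure_itv/= !lte_fin ltrD2r ltr_pM2l//.
    case: ifP => _; last by rewrite mule0.
    rewrite -!EFinB -EFinM; congr EFin.
    by rewrite opprD addrACA subrr addr0 -mulrBr mulKf// gt_eqF.
  apply/seteqP; split => x /=; rewrite !in_itv/= /affine ltr_pdivlMr// ler_pdivrMr//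
    [u * a]mulrC [v * a]mulrC ltrBrDr lerBlDr//.
by rewrite muleA -EFinM divff ?mul1e ?gt_eqF.
Qed.

(* An infinite coin-tossing sequence on [0, 1[ with Lebesgue measure: bit 0 is
   true on [0, p[, and shift maps [0, p[ and [p, 1[ affinely onto [0, 1[. *)
Let shift (x : measurableTypeR R) : measurableTypeR R :=
  if x < p then affine p 0 x else affine (1 - p) p x.
Let bit (n : nat) (x : measurableTypeR R) : bool := iter n shift x < p.

Let measurable_ltp : measurable_fun setT (fun x : measurableTypeR R => x < p).
Proof. exact: measurable_fun_ltr. Qed.

Let measurable_shift : measurable_fun setT shift.
Proof.
apply: measurable_fun_if => //; apply: measurable_funTS; exact: measurable_affine.
Qed.

Let measurable_bit n : measurable_fun setT (bit n).
Proof.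
apply: (measurableT_comp measurable_ltp).
by elim: n => [|n IHn]; [exact: measurable_id|exact: measurableT_comp].
Qed.

Let event (e : nat -> option bool) (n : nat) : set (measurableTypeR R) :=
  [set x | forall i, (i < n)%N -> forall c, e i = Some c -> bit i x = c].

Let weight (o : option bool) : R := if o is Some c then bernoulli_pmf p c else 1.

Let measurable_event e n : measurable (event e n).
Proof.
rewrite [X in measurable X](_ : _ = \bigcap_(i in `I_n)
    \bigcap_(c in [set c | e i = Some c]) (bit i @^-1` [set c])).
  apply: bigcap_measurableType => i _; apply: fin_bigcap_measurable => [|c _]; first exact: finite_finset.
  by rewrite -[X in measurable X]setTI; exact: measurable_bit.
by apply/seteqP; split => x h i; [move=> /h h' c /h'|move=> /h h' c /h'].
Qed.

Let eventS e n : event e n.+1 =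
  [set x | forall c, e 0%N = Some c -> bit 0 x = c] `&`
  shift @^-1` event (e \o S) n.
Proof.
apply/seteqP; split => x.
  move=> h; split; first exact: h.
  by move=> i im c ec; have := h i.+1 im c ec; rewrite /bit iterSr.
move=> [h0 h] [_|i im] c ec; first exact: h0.
by rewrite /bit iterSr; exact: h.
Qed.

Let U_event e n : U (event e n) = (\prod_(i < n) weight (e i))%:E.
Proof.
elim: n e => [|n IHn] e.
  rewrite big_ord0 (_ : event e 0 = setT) ?U_setT//.
  by apply/seteqP; split.
pose B := event (e \o S) n.
pose V c := [set x : measurableTypeR R | bit 0 x = c /\ B (shift x)] `&` I01.
have VT : V true = affine p 0 @^-1` (B `&` I01).
  apply/seteqP; split => x /=.
    rewrite /V/= /bit/= /shift /I01/= !in_itv/= => -[[xp]]; rewrite xp.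
    move=> Bx /andP[x0 _]; split => //.
    by rewrite /affine subr0 divr_ge0 ?(ltW p_gt0)//= ltr_pdivrMr// mul1r.
  rewrite /V/= /bit/= /shift /I01/= !in_itv/= => -[Bx].
  rewrite {1 2}/affine subr0 pmulr_lge0 ?invr_gt0// ltr_pdivrMr// mul1r.
  move=> /andP[x0 xp]; rewrite xp x0; split => //=.
  by rewrite (lt_trans xp)//; case/andP: p01.
have VF : V false = affine (1 - p) p @^-1` (B `&` I01).
  apply/seteqP; split => x /=.
    rewrite /V/= /bit/= /shift /I01/= !in_itv/= => -[[xp]]; rewrite xp.
    move=> Bx /andP[_ x1]; split => //; move/negbT: xp; rewrite -leNgt => xp.
    rewrite /affine divr_ge0 ?(ltW q_gt0) ?subr_ge0//=.
    by rewrite ltr_pdivrMr// mul1r ltrD2r.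
  rewrite /V/= /bit/= /shift /I01/= !in_itv/= => -[Bx].
  rewrite {1 2}/affine pmulr_lge0 ?invr_gt0// ltr_pdivrMr// mul1r ltrD2r subr_ge0.
  move=> /andP[xp ->]; rewrite ltNge xp/= andbT; split => //.
  by rewrite (le_trans _ xp)// ltW.
have mB01 : measurable (B `&` I01) by apply: measurableI => //; exact: measurable_event.
have mV c : measurable (V c).
  by case: c; rewrite ?VT ?VF -[X in measurable X]setTI; exact: measurable_affine.
have UB : mu (B `&` I01) = (\prod_(i < n) weight (e i.+1))%:E by exact: IHn.
have muV c : mu (V c) = (bernoulli_pmf p c * \prod_(i < n) weight (e i.+1))%:E.
  by case: c; rewrite ?VT ?VF mu_affine// UB -EFinM.
rewrite big_ord_recl; under eq_bigr do rewrite lift0.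
rewrite [weight (e ord0)]/weight /=.
case e0: (e 0%N) => [c|].
  rewrite -muV /U/= /mrestr eventS; congr (mu (_ `&` _)).
  apply/seteqP; split => x /= [h ?]; split => //; first exact: h.
  by move=> c'; rewrite e0 => -[<-].
have -> : U (event e n.+1) = mu (V true `|` V false).
  rewrite /U/= /mrestr eventS; congr (mu _); apply/seteqP; split => x /=.
    by move=> [[_ Bx] xI]; case bx: (bit 0 x); [left|right].
  by move=> [|] [[_ Bx] xI]; split=> //; split=> // c; rewrite e0.
transitivity (mu (V true) + mu (V false))%E; last first.
  by rewrite !muV -EFinD -mulrDl /= addrC subrK.
apply: measureU => //.
by apply/seteqP; split => x //= [[[+ _] _] [[+ _] _]] => ->.
Qed.

Lemma bernoulli_field_exists d :
  exists nu : probability (config d) R, bernoulli_field p nu.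
Proof.
pose rank : site d -> nat := @choice.pickle (site d).
have rank_inj : injective rank := pcan_inj choice.pickleK.
pose f (x : measurableTypeR R) : config d := fun s => bit (rank s) x.
have mf : measurable_fun setT f.
  apply: (@measurability _ _ _ _ _ _
    (@coordinate_events d (config d) id setT)) => //.
  move=> _ [_ [s _ [B mB <-]] <-].
  by rewrite setTI; exact: (measurable_bit (rank s)).
pose F : {mfun measurableTypeR R >-> config d} :=
  HB.pack f (isMeasurableFun.Build _ _ _ _ f mf).
pose P : probability (measurableTypeR R) R :=
  HB.pack (U : set _ -> \bar R) (Measure.class U) (Measure_isProbability.Build _ _ _ U U_setT).
exists (distribution P F) => L eta.
pose e i := omap (fun s : L => eta s) [pick s : L | rank (val s) == i].
have eP (s : L) : e (rank (val s)) = Some (eta s).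
  rewrite /e; case: pickP => [t /eqP /rank_inj /val_inj ->//|/(_ s)].
  by rewrite eqxx.
pose n := (\max_(s : L) (rank (val s)).+1)%N.
have rank_lt (s : L) : (rank (val s) < n)%N.
  exact: (leq_bigmax (F := fun s : L => (rank (val s)).+1)).
transitivity (U (event e n)).
  rewrite /distribution /pushforward; congr (U _).
  apply/seteqP; split => x /= h.
    move=> i _ c; rewrite /e; case: pickP => //= s /eqP <- [<-]; exact: h.
  by move=> s; exact: (h _ (rank_lt s) _ (eP s)).
rewrite U_event; congr EFin.
rewrite [RHS](partition_big (fun s : L => Ordinal (rank_lt s)) xpredT)//=.
apply: eq_bigr => i _; rewrite {1}/e; case: pickP => /= [s /eqP si|h].
  rewrite (big_pred1 s)// => t /=.
  by rewrite -val_eqE/= -si (inj_eq rank_inj) (inj_eq val_inj).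
by rewrite big_pred0// => s; rewrite -val_eqE/= h.
Qed.

End bernoulli_field_existence.

(* Main.v *)
Require Import Defs.
From HB Require Import structures.
From mathcomp Require Import all_boot all_order all_algebra finmap.
From mathcomp Require Import all_classical all_reals all_analysis measurable_realfun.
From mathcomp Require Import zify ring lra.
Set Implicit Arguments.
Unset Strict Implicit.
Unset Printing Implicit Defensive.
Import Order.TTheory GRing.Theory Num.Theory.
Import numFieldNormedType.Exports.
Local Open Scope classical_set_scope.
Local Open Scope ring_scope.

(** Let [T] be the thinning map and fix the plane spanned by the first two coordinate
    axes. Suppose that the image configuration is empty at distance at most one from a
    diamond of radius [n] in this plane and full around it. Then the sites at distance
    one are vacant in the underlying field, because each has an occupied neighbour at
    distance two; those beyond are occupied; and on the diamond the particles are
    isolated. So the underlying field on the diamond is a hard-core model, whose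
    activity [lam = p / (1 - p)] is large when [p] is close to one.

    For large activity this model has long-range order: the sites whose parity is that
    of [n], such as those on the rim, are mostly occupied, and the others are mostly
    vacant. This is a Peierls argument ([peierls]). A particle of the wrong parity is
    surrounded by a contour. Both sides of the contour are vacant, so the
    configuration inside can be moved by one step to the right, and the vacated sites
    on the left can be filled ([shift]). This gains a factor [lam ^ m] for a contour of
    length proportional to [m], against at most [C ^ m] contours. Contours are handled
    by parity: the horizontal boundary edges of the wrong phase form a finite set, the
    inside of a union of components is defined by counting crossings with a ray
    ([inside]), and a smallest union around a given site is the trace of a short walk
    ([irreducible_trace]).

    The order is visible in the image, near the origin. If the four planar neighbours
    of the origin are occupied, then an occupied origin produces a cross of five
    non-isolated sites, and a vacant one produces an empty image. Given the image
    outside the cross, the ratio of the probabilities of a full and of an empty cross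
    is thus [lam] times the hard-core probability that the origin is surrounded: at most
    [lam / 4] for even [n] ([surrounded_rare]) and at least [3 lam / 4] for odd [n]
    ([surrounded_likely]).

    A specification must reproduce these conditional probabilities as averages
    ([kernel_mean]). As [n] grows, the conditions outside the cross converge to the
    configuration that is empty at distance at most one from the plane and full
    elsewhere. If the specification is quasilocal, both conditional probabilities
    converge ([walled_limit]), and the one of the empty cross stays away from zero
    ([hardcore_sum_off_cross]); this contradicts the oscillation of the ratio. *)

(** * Points of the square lattice *)

Notation plane := (int * int)%type.
Definition e1 : plane := (1, 0).
Definition e2 : plane := (0, 1).

Definition norm1 (x : plane) : nat := (`|x.1| + `|x.2|)%N.
Arguments norm1 x%_R.
Definition adj (x y : plane) : bool := (`|(x.1 - y.1)%R| + `|(x.2 - y.2)%R| == 1)%N.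
Definition king (x y : plane) : bool :=
  (`|(x.1 - y.1)%R| <= 1)%N && (`|(x.2 - y.2)%R| <= 1)%N.
(** Locked, so that simplification does not unfold membership in it. *)
Definition nbrs (x : plane) : seq plane := locked [:: x + e1; x - e1; x + e2; x - e2].

Lemma nbrsE x : nbrs x = [:: x + e1; x - e1; x + e2; x - e2].
Proof. by rewrite /nbrs -lock. Qed.

Lemma adjC x y : adj x y = adj y x.
Proof. rewrite /adj; lia. Qed.

Lemma adj_addr x y z : adj (x + z) (y + z) = adj x y.
Proof. case: x y z => [x1 x2] [y1 y2] [z1 z2]; rewrite /adj /=; lia. Qed.

Lemma mem_nbrs x y : (y \in nbrs x) = adj x y.
Proof.
case: x y => [x1 x2] [y1 y2]; rewrite nbrsE /adj !inE /=.
rewrite -!pair_eqE /pair_eq /=; lia.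
Qed.

Lemma adj_norm1 x y : adj x y -> odd (norm1 y) = ~~ odd (norm1 x).
Proof. case: x y => [x1 x2] [y1 y2]; rewrite /adj /norm1 /=; lia. Qed.

Lemma kingC x y : king x y = king y x.
Proof. rewrite /king; lia. Qed.

Lemma diamond_fset n : {A : {fset plane} | forall x, (x \in A) = (norm1 x <= n)%N}.
Proof.
pose s : seq plane := allpairs (fun i j : nat => (i%:Z - n%:Z, j%:Z - n%:Z))
  (iota 0 (2 * n).+1) (iota 0 (2 * n).+1).
exists [fset x in s | (norm1 x <= n)%N]%fset => x.
rewrite in_fset; apply/andb_idl => le_xn; apply/allpairsP.
exists (absz (x.1 + n%:Z), absz (x.2 + n%:Z)); rewrite !mem_iota /=.
case: x le_xn => [x1 x2]; rewrite /norm1 /= => le_xn; split; [lia..|].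
congr pair; lia.
Qed.

Definition diamond n : {fset plane} := sval (diamond_fset n).

Lemma mem_diamond n x : (x \in diamond n) = (norm1 x <= n)%N.
Proof. exact: (svalP (diamond_fset n)). Qed.

(** Adjacency, norms and equality of points are linear arithmetic once every point is
    split into its coordinates. *)
Ltac plane_lia :=
  intros;
  repeat match goal with
  | x : prod int int |- _ => destruct x as [? ?]
  | x : Choice.sort _ |- _ => let t := type of x in unify t plane; destruct x as [? ?]
  end;
  repeat match goal with
  | H : context [_ == _ :> prod _ _] |- _ => rewrite -pair_eqE /pair_eq /= in H
  | |- context [_ == _ :> prod _ _] => rewrite -pair_eqE /pair_eq /=
  end;
  cbv [norm1 adj king e1 e2] in *; cbn [fst snd] in *; simpl in *; lia.

(** * The inside of a set of horizontal edges *)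

Definition ray (K : {fset plane}) (x : plane) : {fset plane} :=
  [fset y in K | (y.2 == x.2) && (x.1 <= y.1)]%fset.
(** Crossing parity. The point [y] of [K] stands for the horizontal edge from [y] to
    [y + e1], and [x] is inside [K] when the ray from [x] to the right runs through
    an odd number of these edges. *)
Definition inside (K : {fset plane}) (x : plane) : bool := odd #|` ray K x|.

Lemma mem_ray K x y : (y \in ray K x) = [&& y \in K, y.2 == x.2 & x.1 <= y.1].
Proof. by rewrite in_fset. Qed.

Lemma inside_e1 K x : inside K x = (x \in K) (+) inside K (x + e1).
Proof.
rewrite /inside (cardfsD1 x) mem_ray eqxx lexx !andbT oddD oddb.
congr (_ (+) odd #|` _|); apply/fsetP => y; rewrite in_fsetD1 !mem_ray.
case: (y \in K); rewrite ?andbF ?andbT //=.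
case: x y => [x1 x2] [y1 y2] /=; rewrite -pair_eqE /pair_eq /=; lia.
Qed.

Lemma inside_right K (b : nat) x :
  (forall y, y \in K -> (norm1 y <= b)%N) -> (b < norm1 x)%N -> 0 <= x.1 -> inside K x = false.
Proof.
move=> Kb bx x0; rewrite /inside (_ : ray K x = fset0) ?cardfs0 //.
apply/fsetP => y; rewrite mem_ray in_fset0; apply/negP => /and3P[/Kb + /eqP yx xy].
by clear Kb; plane_lia.
Qed.

Lemma inside_far K (b : nat) x :
  (forall y, y \in K -> (norm1 y <= b)%N) -> (b < `|x.2|)%N -> inside K x = false.
Proof.
move=> Kb bx; rewrite /inside (_ : ray K x = fset0) ?cardfs0 //.
apply/fsetP => y; rewrite mem_ray in_fset0; apply/negP => /and3P[/Kb + /eqP yx xy].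
by clear Kb; plane_lia.
Qed.

(** * Walks with king moves *)

(** The king moves and the null move: a finite alphabet, so that walks can be
    counted. *)
Notation step := ('I_3 * 'I_3)%type.
Definition stepv (s : step) : plane := (s.1%:Z - 1, s.2%:Z - 1).

Fixpoint trace (z : plane) (w : seq step) : seq plane :=
  z :: (if w is s :: w' then trace (z + stepv s) w' else [::]).

Lemma trace_head z w : z \in trace z w.
Proof. by case: w => [|s w] /=; rewrite inE eqxx. Qed.

Lemma king_step x y : king x y -> exists s, y = x + stepv s.
Proof.
move=> xy; exists (inord (absz (y.1 - x.1 + 1)%R), inord (absz (y.2 - x.2 + 1)%R)).
case: x y xy => [x1 x2] [y1 y2]; rewrite /king /stepv /= => xy.
by rewrite !inordK; [congr pair|..]; rewrite /=; lia.
Qed.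

(** An excursion to a neighbouring site and back adds one site to a trace for two
    steps; this is how a connected set of [k] sites is exhausted in [2 k] steps. *)
Lemma trace_detour z w x y : x \in trace z w -> king x y ->
  exists2 w', size w' = (size w).+2 & trace z w' =i y :: trace z w.
Proof.
elim: w z => [|s w IHw] z /=.
  rewrite inE => /eqP-> zy; have [s ys] := king_step zy.
  rewrite kingC in zy; have [s' zs'] := king_step zy.
  exists [:: s; s'] => //= t; rewrite -ys -zs' !inE.
  by case: (t == z); case: (t == y).
rewrite inE; case: (eqVneq x z) => [-> _ zy|_ /= xw xy].
  have [s0 ys] := king_step zy.
  rewrite kingC in zy; have [s' zs'] := king_step zy.
  exists [:: s0, s', s & w] => //= t; rewrite -ys -zs' !inE.
  by case: (t == z); case: (t == y).
have [w' sw' Ew'] := IHw _ xw xy; exists (s :: w') => /= [|t]; first by rewrite sw'.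
by rewrite !inE Ew' inE orbCA.
Qed.

Lemma trace_column z w y : y \in trace z w -> z.1 - y.1 <= (size w)%:Z.
Proof.
elim: w z => [|s w IHw] z /=; first by rewrite inE => /eqP ->; rewrite subrr.
rewrite inE => /predU1P[->|/IHw]; first by rewrite subrr.
by case: s z => [[i ilt] j] [z1 z2]; rewrite /stepv /=; lia.
Qed.

(** * Components of the boundary of a region *)

(* P will be the region of the wrong phase. *)
Section Contour.
Variables (n : nat) (P : pred plane).
Hypothesis P_fin : forall x, P x -> (norm1 x <= n)%N.
Hypothesis P_bd : forall x y, adj x y -> P x -> ~~ P y -> odd (norm1 x) = odd n.

(** The horizontal edges of the boundary of [P], encoded by their left ends. *)
Definition jumps : {fset plane} := [fset x in diamond n.+1 | P x (+) P (x + e1)%R]%fset.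

Lemma mem_jumps x : (x \in jumps) = P x (+) P (x + e1).
Proof.
rewrite !inE mem_diamond; apply/andb_idl.
have [/P_fin|_] := boolP (P x); first by rewrite /norm1; lia.
by move=> /P_fin; case: x => [x1 x2]; rewrite /norm1 /=; lia.
Qed.

(** A union of connected components of the boundary of [P]. Horizontal boundary
    edges of the same unit square, or of two squares with a common vertical boundary
    edge, differ by a king move, so the horizontal edges carry the connectivity. *)
Definition closed_in (K : {fset plane}) : Prop :=
  {subset K <= jumps} /\
  forall x y, x \in K -> y \in jumps -> king x y -> y \in K.

Lemma closed_norm1 K y : closed_in K -> y \in K -> (norm1 y <= n.+1)%N.
Proof. by case=> KH _ /KH; rewrite !inE mem_diamond => /andP[]. Qed.

(** The boundary of [P] never runs straight through a unit square: the two ends in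
    [P] of parallel boundary edges would be adjacent, while all sites of [P] on its
    boundary have the same parity. *)
Lemma no_parallel_boundary x y x' y' : adj x y -> adj x' y' -> adj x x' -> adj y y' ->
  P x = P x' -> P y = P y' -> P x = P y.
Proof.
move=> xy xy' xx yy Ex Ey; have yx := xy; have yx' := xy'; rewrite adjC in yx; rewrite adjC in yx'.
case Px: (P x); case Py: (P y) => //.
- have px : odd (norm1 x) = odd n by apply: (P_bd xy); rewrite ?Px ?Py.
  have := P_bd xy'; rewrite -Ex -Ey Px Py (adj_norm1 xx) px => /(_ isT isT).
  by case: odd.
- have py : odd (norm1 y) = odd n by apply: (P_bd yx); rewrite ?Px ?Py.
  have := P_bd yx'; rewrite -Ex -Ey Px Py (adj_norm1 yy) py => /(_ isT isT).
  by case: odd.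
Qed.

Lemma not_flat_h x : P x = P (x + e1) -> P (x + e2) = P (x + e1 + e2) -> P x = P (x + e2).
Proof. by apply: no_parallel_boundary; clear; plane_lia. Qed.

Lemma not_flat_v x : P x = P (x + e2) -> P (x + e1) = P (x + e1 + e2) -> P x = P (x + e1).
Proof. by apply: no_parallel_boundary; clear; plane_lia. Qed.

(** Properties of rays to the right are proved by moving their origin to the left,
    starting from the region where the rays are empty. *)
Lemma right_ind (Q : plane -> Prop) (b : nat) :
  (forall x, (b < norm1 x)%N -> 0 <= x.1 -> Q x) -> (forall x, Q (x + e1) -> Q x) ->
  forall x, Q x.
Proof.
move=> Qb Qs x; have [m] : exists m : nat, (b%:Z + 1 <= x.1 + m%:Z :> int)%R.
  by exists (absz (b%:Z + 1 - x.1)%R); lia.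
elim: m x => [|m IHm] x hx; first by apply: Qb; rewrite /norm1; lia.
by apply/Qs/IHm; rewrite /=; lia.
Qed.

Lemma king_block x y z : y \in [:: x; x + e1; x + e2; x + e1 + e2] ->
  z \in [:: x; x + e1; x + e2; x + e1 + e2] -> king y z.
Proof.
by rewrite !inE => /or4P[]/eqP-> /or4P[]/eqP->; clear; plane_lia.
Qed.

(** The reason why [inside K] is the interior of a curve. It changes along a vertical
    edge only if this edge is on the boundary of [P], and then iff the edge belongs
    to the component [K]. When the origin of the ray moves one step to the left, the
    ray gains one unit square, and the claim for its left side follows from the claim
    for its right side because the boundary of [P] does not run straight through it. *)
Lemma inside_e2 K x : closed_in K ->
  inside K x (+) inside K (x + e2) =
  (P x (+) P (x + e2)) && ((x \in K) || (x + e2 \in K)).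
Proof.
move=> cK; have Kn := fun y => @closed_norm1 K y cK; case: (cK) => KH Kc.
move: x; apply: (@right_ind _ n.+2) => [x nx x0|x IHx].
  have nx2 : (n.+1 < norm1 (x + e2))%N by clear -nx; plane_lia.
  rewrite !(inside_right Kn) ?(ltnW nx) //; last by clear -x0; plane_lia.
  case: (boolP (P x)) => [/P_fin|_]; first lia.
  by case: (boolP (P (x + e2))) => [/P_fin|_]; first lia.
rewrite addrAC in IHx; rewrite inside_e1 (inside_e1 K (x + e2)) (addrAC x e2 e1).
(* The boundary edges of one unit square lie together in K or outside K. *)
have same y z : y \in [:: x; x + e1; x + e2; x + e1 + e2] ->
    z \in [:: x; x + e1; x + e2; x + e1 + e2] -> z \in jumps -> y \in K -> z \in K.
  by move=> yx zx zj yK; apply: Kc yK zj _; exact: king_block yx zx.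
have [ma mb mc md] : [/\ x \in [:: x; x + e1; x + e2; x + e1 + e2],
    x + e2 \in [:: x; x + e1; x + e2; x + e1 + e2],
    x + e1 \in [:: x; x + e1; x + e2; x + e1 + e2] &
    x + e1 + e2 \in [:: x; x + e1; x + e2; x + e1 + e2]].
  by rewrite !inE !eqxx !orbT.
have sab := same _ _ ma mb; have sac := same _ _ ma mc.
have sad := same _ _ ma md; have sba := same _ _ mb ma.
have sbc := same _ _ mb mc; have sbd := same _ _ mb md.
have sca := same _ _ mc ma; have scb := same _ _ mc mb.
have scd := same _ _ mc md; have sda := same _ _ md ma.
have sdb := same _ _ md mb; have sdc := same _ _ md mc.
(* What remains depends on P at the corners of two neighbouring unit squares and
   on K at the four ends of their horizontal edges. *)
have ka := KH x; have kb := KH (x + e2).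
have fl0 := @not_flat_h x; have fl1 := @not_flat_h (x + e1).
move: IHx sab sac sad sba sbc sbd sca scb scd sda sdb sdc ka kb fl0 fl1.
rewrite !mem_jumps (addrAC x e2 e1) (addrAC (x + e1) e2 e1).
move: (x \in K) (x + e2 \in K) (x + e1 \in K) (x + e1 + e2 \in K) => a b c d.
move: (P x) (P (x + e2)) (P (x + e1)) (P (x + e1 + e2)) => pa pb pc pd.
move: (P _) (P _) (inside _ _) (inside _ _) => pe pf ic id.
clear; rewrite /is_true.
case: ic id => [] []; case: a b c d => [] [] [] []; case: pa pb pc pd => [] [] [] [] //=;
  case: pe pf => [] [] //=; intuition congruence.
Qed.

Lemma inside_jumps x : inside jumps x = P x.
Proof.
have jn y : y \in jumps -> (norm1 y <= n.+1)%N by rewrite !inE mem_diamond => /andP[].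
move: x; apply: (@right_ind _ n.+1) => [x nx x0|x IHx].
  by rewrite (inside_right jn) //; apply/esym/negP => /P_fin; lia.
by rewrite inside_e1 IHx mem_jumps -addbA addbb addbF.
Qed.

Lemma closed_in_jumps : closed_in jumps.
Proof. by split. Qed.

Lemma closed_in_diff K T : closed_in K -> closed_in T -> closed_in (K `\` T)%fset.
Proof.
move=> [KH Kc] [TH Tc]; split=> [x|x y]; rewrite !in_fsetD => /andP[xT xK]; first exact: KH.
move=> yH xy; rewrite (Kc _ _ xK yH xy) andbT; apply: contra xT => yT.
by apply: Tc yT (KH _ xK) _; rewrite kingC.
Qed.

Lemma inside_diff K T x : {subset T <= K} ->
  inside K x = inside T x (+) inside (K `\` T)%fset x.
Proof.
move=> TK; rewrite /inside -oddD -(cardfsID (ray T x) (ray K x)); congr (odd (_ + _)%N);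
  congr (size (enum_fset _)).
  apply/fsetP => y; rewrite in_fsetI !mem_ray; case yT: (y \in T).
    by rewrite (TK _ yT) /= andbb.
  by rewrite /= andbF.
apply/fsetP => y; rewrite in_fsetD !mem_ray in_fsetD.
by case: (y \in T); case: (y \in K); rewrite ?andbF ?andNb ?andbT //= ?andNb.
Qed.

(** Connectedness of a component, stated as minimality. *)
Definition irreducible_in (K : {fset plane}) :=
  forall T : {fset plane}, {subset T <= K} -> closed_in T -> T != fset0 -> T = K.

(** When a union of components splits in two, the crossing parities add up, so one of
    the two parts still surrounds [u]. *)
Lemma irreducible_around u : P u ->
  exists K, [/\ closed_in K, inside K u & irreducible_in K].
Proof.
rewrite -inside_jumps => uj; move: closed_in_jumps uj.
have [k] := ubnP #|` jumps|; move: jumps => K; elim: k K => [//|k IHk] K sK cK uK.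
have [iK|] := EM (irreducible_in K); first by exists K.
move=> /existsNP[T /not_implyP[TK /not_implyP[cT /not_implyP[T0 /eqP TnK]]]].
move: uK; rewrite (inside_diff u TK).
have cKT := closed_in_diff cK cT.
have TK' : (T `<=` K)%fset by apply/fsubsetP.
have sT : (#|` T| < #|` K|)%N by rewrite fproper_ltn_card // fproperEneq TnK.
have sKT : (#|` (K `\` T)%fset| < #|` K|)%N.
  by rewrite cardfsDS // ltn_subrL (leq_ltn_trans _ sT) // andbT cardfs_gt0.
case uT: (inside T u) => /= uKT.
  by apply: (IHk T) => //; apply: leq_trans sT _.
by apply: (IHk _ _ cKT uKT); apply: leq_trans sKT _.
Qed.

(** The trace of a walk that has not exhausted [K] is not a union of components, so
    some boundary edge next to it is missing and can be reached by a detour. *)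
Lemma irreducible_trace K a : closed_in K -> irreducible_in K -> a \in K ->
  exists2 w, size w = (2 * #|` K|)%N & trace a w =i K.
Proof.
move=> cK iK aK.
have K0 : (0 < #|` K|)%N by rewrite cardfs_gt0; apply/fset0Pn; exists a.
(* A walk of 2 (j + 1) steps visits j + 1 sites; the two spare steps come from the
   null excursion at the start. *)
have ext j : (j < #|` K|)%N -> exists w (T : {fset plane}),
    [/\ size w = (2 * j.+1)%N, trace a w =i T, {subset T <= K} & #|` T| = j.+1].
  elim: j => [_|j IHj jK].
    have aa : king a a by clear; plane_lia.
    have [w sw Ew] := @trace_detour a [::] a a (trace_head _ _) aa.
    exists w, [fset a]%fset; split=> //; last by rewrite cardfs1.
      by move=> t; rewrite Ew !inE orbb.
    by move=> t; rewrite inE => /eqP ->.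
  have [w [T [sw Ew TK sT]]] := IHj (ltnW jK).
  have : ~ closed_in T.
    move=> cT; have T0 : T != fset0 by rewrite -cardfs_gt0 sT.
    by move: jK; rewrite -(iK T TK cT T0) sT ltnn.
  move=> /not_andP[[]|]; first by move=> x /TK; case: cK => + _; apply.
  move=> /existsNP[x /existsNP[y /not_implyP[xT /not_implyP[yH /not_implyP[xy /negP yT]]]]].
  rewrite -Ew in xT; have [w' sw' Ew'] := trace_detour xT xy.
  exists w', (y |` T)%fset; split.
  - by rewrite sw' sw; lia.
  - by move=> t; rewrite Ew' !inE Ew.
  - move=> t; rewrite !inE => /orP[/eqP ->|/TK //].
    by case: cK => _; apply; [apply: TK; rewrite -Ew; exact: xT| |].
  - by rewrite cardfsU1 yT sT.
have [|w [T [sw Ew TK sT]]] := ext #|` K|.-1; first by rewrite prednK.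
rewrite prednK // in sw sT; exists w => // t; rewrite Ew.
suff -> : T = K by [].
by apply/eqP; rewrite eqEfcard sT leqnn andbT; apply/fsubsetP.
Qed.

(** From a site outside the diamond, a vertical ray pointing away from the horizontal
    axis avoids [P] and ends beyond all edges of [K]. *)
Lemma inside_fin K x : closed_in K -> inside K x -> (norm1 x <= n)%N.
Proof.
move=> cK; apply: contraTT; rewrite -ltnNge => nx.
have stepE y : (n < norm1 y)%N -> (n < norm1 (y + e2))%N -> inside K y = inside K (y + e2).
  move=> ny ny2; have := inside_e2 y cK.
  have /negbTE -> : ~~ P y by apply: contraL ny => /P_fin; rewrite -leqNgt.
  have /negbTE -> : ~~ P (y + e2) by apply: contraL ny2 => /P_fin; rewrite -leqNgt.
  by case: inside; case: inside.
(* The vertical ray points upwards or downwards according to the sign of x.2. *)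
have up m : 0 <= x.2 -> inside K x = inside K (x.1, x.2 + m%:Z).
  move=> x0; elim: m => [|m IHm]; first by rewrite addr0; case: (x).
  rewrite IHm stepE; [|by clear -nx x0; plane_lia..].
  by congr inside; apply/eqP; clear; plane_lia.
have down m : x.2 <= 0 -> inside K x = inside K (x.1, x.2 - m%:Z).
  move=> x0; elim: m => [|m IHm]; first by rewrite subr0; case: (x).
  rewrite IHm [RHS]stepE; [|by clear -nx x0; plane_lia..].
  by congr inside; apply/eqP; clear; plane_lia.
have far := @inside_far K n.+1 _ (fun y yK => closed_norm1 cK yK).
case: (lerP 0 x.2) => x0.
  by rewrite (up n.+2) // far //=; clear -x0; plane_lia.
by rewrite (down n.+2) ?ltW // far //=; clear -x0; plane_lia.
Qed.

End Contour.

(** * Removing a contour by a shift *)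

Definition indep (S : {fset plane}) : bool := all (fun x => all (fun y => ~~ adj x y) S) S.

Lemma indepP (S : {fset plane}) :
  reflect (forall x y, x \in S -> y \in S -> adj x y = false) (indep S).
Proof.
apply: (iffP allP) => [H x y xS yS|H x xS].
  by have /allP/(_ y yS)/negbTE := H x xS.
by apply/allP => y yS; rewrite (H x y xS yS).
Qed.

(** The sites that a shift of the inside by [e1] vacates and does not refill. *)
Definition left_rim n K : {fset plane} :=
  [fset x in diamond n | inside K x && ~~ inside K (x - e1)%R]%fset.

(** The second clause says that the boundary of the inside does not run vertically
    through a unit square; then no two sites of the left rim are adjacent. *)
Definition is_contour n (K : {fset plane}) : Prop :=
  (forall x, inside K x -> (norm1 x <= n)%N) /\
  (forall x, inside K x = inside K (x + e2) -> inside K (x + e1) = inside K (x + e1 + e2) ->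
    inside K x = inside K (x + e1)).

Definition clear_along (K S : {fset plane}) : Prop :=
  forall x y, adj x y -> inside K x -> ~~ inside K y -> x \notin S /\ y \notin S.

(** The configuration inside [K] is translated by [e1] and the vacated rim is filled,
    which is expressed by a membership condition on the new configuration. *)
Definition shift n (K S : {fset plane}) : {fset plane} :=
  [fset y in diamond n | if inside K y then ~~ inside K (y - e1)%R || ((y - e1)%R \in S)
                   else y \in S]%fset.

(** The edges of [K] are the left and the right ends of the rows of the inside, which
    are equinumerous: the inside meets its two translates by [e1] and [- e1] in sets of
    the same size. *)
Lemma card_contour n K : is_contour n K -> #|` K| = (2 * #|` left_rim n K|)%N.
Proof.
move=> [Kn _].
pose I : {fset plane} := [fset x in diamond n | inside K x]%fset.
have mI x : (x \in I) = inside K x by rewrite !inE mem_diamond andb_idl // => /Kn.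
have mL : left_rim n K = (I `\` [fset (x + e1)%R | x in I])%fset.
  apply/fsetP => x; rewrite in_fsetD !inE mem_diamond.
  have -> : (x \in [fset (x + e1)%R | x in I]%fset) = inside K (x - e1).
    apply/imfsetP/idP => [[y /= yI ->]|xI]; first by rewrite addrK -mI.
    by exists (x - e1) => /=; rewrite ?mI ?subrK.
  by rewrite andbCA andbC; case: inside; case: inside => //=; rewrite ?andbF ?andbT.
pose Rr := (I `\` [fset (x - e1)%R | x in I])%fset.
have mR x : (x \in Rr) = inside K x && ~~ inside K (x + e1).
  rewrite in_fsetD mI andbC; congr (_ && ~~ _).
  apply/imfsetP/idP => [[y /= yI ->]|xI]; first by rewrite subrK -mI.
  by exists (x + e1) => /=; rewrite ?mI ?addrK.
have cR : #|` Rr| = #|` left_rim n K|.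
  rewrite mL; have := cardfsID [fset (x + e1)%R | x in I]%fset I.
  have := cardfsID [fset (x - e1)%R | x in I]%fset I.
  suff -> : #|` (I `&` [fset (x - e1)%R | x in I])%fset| =
            #|` (I `&` [fset (x + e1)%R | x in I])%fset|.
    by rewrite /Rr => <- /addnI ->.
  have -> : (I `&` [fset (x + e1)%R | x in I])%fset =
      [fset (x + e1)%R | x in (I `&` [fset (x - e1)%R | x in I])%fset]%fset.
    apply/fsetP => x; rewrite in_fsetI; apply/andP/imfsetP => /=.
      move=> [xI /imfsetP[y /= yI xy]]; exists y => //; rewrite in_fsetI yI /=.
      by apply/imfsetP; exists x => //=; rewrite xy addrK.
    move=> [y + ->]; rewrite in_fsetI => /andP[yI /imfsetP[z /= zI yz]].
    by rewrite yz subrK zI; split=> //; apply/imfsetP; exists y; rewrite // yz subrK.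
  by rewrite [RHS]card_imfset //= => x y; apply: addIr.
have EK : K = (Rr `|` [fset (x - e1)%R | x in left_rim n K])%fset.
  apply/fsetP => x; rewrite in_fsetU mR.
  have -> : (x \in [fset (x - e1)%R | x in left_rim n K]%fset) =
      ~~ inside K x && inside K (x + e1).
    apply/imfsetP/idP => [[y /= + ->]|/andP[x1 x2]].
      by rewrite !inE subrK andbC => /andP[/andP[-> ->]].
    by exists (x + e1); rewrite ?addrK //= !inE addrK x1 x2 mem_diamond Kn.
  have := inside_e1 K x; case: (x \in K); case: (inside K x); case: inside => //.
have cL : #|` [fset (x - e1)%R | x in left_rim n K]%fset| = #|` left_rim n K|.
  by rewrite card_imfset //= => x y; apply: addIr.
rewrite {1}EK cardfsU cL cR.
suff -> : (Rr `&` [fset (x - e1)%R | x in left_rim n K])%fset = fset0.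
  by rewrite cardfs0 subn0 mul2n addnn.
apply/fsetP => x; rewrite in_fsetI mR in_fset0; apply/negP => /andP[/andP[_ /negP xx]].
by move=> /imfsetP[y /= + xy]; rewrite !inE => /and3P[_ yy _]; rewrite xy subrK in xx.
Qed.

Section Shift.
Variables (n : nat) (K : {fset plane}).
Hypothesis cK : is_contour n K.

Lemma mem_left x : (x \in left_rim n K) = inside K x && ~~ inside K (x - e1).
Proof. by case: cK => Kn _; rewrite !inE mem_diamond andb_idl // => /andP[/Kn]. Qed.

Lemma adj_e1 x : adj x (x + e1). Proof. by clear; plane_lia. Qed.

Lemma mem_shift S y : {subset S <= diamond n} -> (y \in shift n K S) =
  if inside K y then ~~ inside K (y - e1) || (y - e1 \in S) else y \in S.
Proof.
case: cK => Kn _ Sn; rewrite !inE mem_diamond andb_idl //.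
by case: ifP => [/Kn //|_ /Sn]; rewrite mem_diamond.
Qed.

Lemma shift_sub S : {subset shift n K S <= diamond n}.
Proof. by move=> x; rewrite !inE => /andP[]. Qed.

(** Both sides of the contour are vacant, so a translated particle stays inside and
    touches neither the particles outside nor the filled rim. *)
Lemma shift_indep S : {subset S <= diamond n} -> clear_along K S -> indep S ->
  indep (shift n K S).
Proof.
case: (cK) => Kn Kf Sn cl /indepP iS.
have out y z : adj y z -> y \in shift n K S -> z \in shift n K S ->
    inside K z -> inside K y.
  move=> yz + _ zI; rewrite mem_shift //; case: ifP => // yI yS.
  by rewrite adjC in yz; have [_] := cl _ _ yz zI (negbT yI); rewrite yS.
have mixed y z : adj y z -> inside K y -> ~~ inside K (y - e1) ->
    inside K (z - e1) -> z - e1 \in S -> False.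
  move=> yz _ yl zl zS; have yz1 : adj (z - e1) (y - e1) by rewrite adj_addr adjC.
  by have [] := cl _ _ yz1 zl yl; rewrite zS.
have flat y z : adj y z -> inside K y -> inside K z ->
    ~~ inside K (y - e1) -> ~~ inside K (z - e1) -> False.
  move=> yz yI zI yl zl.
  have [zy|zy] : (z = y + e2 \/ z + e2 = y) \/ (z = y + e1 \/ z + e1 = y).
    rewrite -mem_nbrs nbrsE !inE in yz; move: yz => /or4P[]/eqP->; rewrite ?subrK; tauto.
  - case: zy => [zy|zy].
      have := Kf (y - e1); rewrite subrK yI -zy zI addrAC -zy (negbTE yl) (negbTE zl).
      by move=> /(_ erefl erefl).
    have := Kf (z - e1); rewrite subrK zI zy yI addrAC zy (negbTE yl) (negbTE zl).
    by move=> /(_ erefl erefl).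
  - case: zy => zy; first by move: zl; rewrite zy addrK yI.
    by move: yl; rewrite -zy addrK zI.
apply/indepP => y z yS zS; apply/negP => yz.
have zy : adj z y by rewrite adjC.
have yzI : inside K y = inside K z by apply/idP/idP; apply: out.
move: (yS) (zS); rewrite !mem_shift // yzI; case: ifP => [zI|_ yS' zS']; last first.
  by rewrite iS in yz.
have yI : inside K y by rewrite yzI.
case: (boolP (inside K (y - e1))) => yl; case: (boolP (inside K (z - e1))) => zl /=.
- move=> y1 z1; have : adj (y - e1) (z - e1) by rewrite adj_addr.
  by rewrite iS.
- by move=> y1 _; exact: (mixed z y).
- by move=> _ z1; exact: (mixed y z).
- by move=> _ _; exact: (flat y z).
Qed.

(** The translation can be undone: the particles it would forget are those on the
    right rim, which is vacant. *)
Lemma shift_inj S S' : {subset S <= diamond n} -> {subset S' <= diamond n} ->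
  clear_along K S -> clear_along K S' -> shift n K S = shift n K S' -> S = S'.
Proof.
move=> Sn S'n cl cl' E; apply/fsetP => x.
have := fun y => congr1 (fun A : {fset plane} => y \in A) E.
move=> Ex; have := Ex x; have := Ex (x + e1); rewrite !mem_shift // addrK.
case: (boolP (inside K x)) => // xI; case: (boolP (inside K (x + e1))) => //= x1I _ _.
have [/negbTE -> _] := cl _ _ (adj_e1 x) xI x1I.
by have [/negbTE -> _] := cl' _ _ (adj_e1 x) xI x1I.
Qed.

Lemma card_shift S : {subset S <= diamond n} -> clear_along K S ->
  #|` shift n K S| = (#|` S| + #|` left_rim n K|)%N.
Proof.
case: (cK) => Kn _ Sn cl; pose g (x : plane) : plane := if inside K x then x + e1 else x.
have gI x : x \in S -> inside K (g x) = inside K x.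
  rewrite /g; case: ifP => // xI xS; apply/negPn/negP => x1I.
  by have [] := cl _ _ (adj_e1 x) xI x1I; rewrite xS.
have ginj : {in S &, injective g}.
  move=> x y xS yS E; have := gI x xS; rewrite E gI // => xy.
  by move: E; rewrite /g xy; case: ifP => // _; apply: addIr.
have -> : shift n K S = (left_rim n K `|` [fset g x | x in S])%fset.
  apply/fsetP => y; rewrite in_fsetU mem_shift // mem_left.
  case: ifP => yI /=.
    case: (boolP (inside K (y - e1))) => //= yl; apply/idP/imfsetP => [yS|[x /= xS yx]].
      by exists (y - e1); rewrite //= /g yl subrK.
    by move: yI; rewrite yx gI // /g => xI; rewrite xI addrK.
  apply/idP/imfsetP => [yS|[x /= xS yx]]; first by exists y; rewrite //= /g yI.
  by move: yI; rewrite yx gI // /g => xI; rewrite xI.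
rewrite cardfsU (_ : _ `&` _ = fset0)%fset; last first.
  apply/fsetP => y; rewrite in_fsetI mem_left in_fset0; apply/negP => /andP[/andP[yI yl]].
  move=> /imfsetP[x /= xS yx]; move: yI yl; rewrite yx gI // /g => xI.
  by rewrite xI addrK xI.
by rewrite cardfs0 subn0 addnC card_in_imfset.
Qed.

End Shift.

(** * The contour around a site of the wrong parity *)

(** The region of the wrong phase: occupied sites whose parity is not that of [n],
    and their neighbours. The rim of the diamond has the parity of [n], so such
    particles lie off the rim and the region fits into the diamond. *)
Definition wrong_cover n (S : {fset plane}) : pred plane := fun x =>
  if odd (norm1 x) == odd n then has (mem S) (nbrs x) else x \in S.

Section WrongCover.
Variables (n : nat) (S : {fset plane}).
Hypotheses (Sn : {subset S <= diamond n}) (iS : indep S).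

Lemma wrong_cover_fin x : wrong_cover n S x -> (norm1 x <= n)%N.
Proof.
rewrite /wrong_cover; case: eqVneq => [xn|_ /Sn]; last by rewrite mem_diamond.
case/hasP => y; rewrite mem_nbrs => xy /Sn; rewrite mem_diamond => yn.
have := adj_norm1 xy; rewrite xn => ny.
have : norm1 y != n by apply: contra_eq_neq ny => ->; case: odd.
by move: xy yn; clear; plane_lia.
Qed.

(** A boundary edge joins a neighbour of a wrong particle to a site of the wrong
    parity that is not occupied. *)
Lemma wrong_cover_boundary x y : adj x y -> wrong_cover n S x -> ~~ wrong_cover n S y ->
  [/\ odd (norm1 x) = odd n, x \notin S & y \notin S].
Proof.
rewrite /wrong_cover => xy; rewrite (adj_norm1 xy); have yx := xy; rewrite adjC in yx.
have -> : (~~ odd (norm1 x) == odd n) = ~~ (odd (norm1 x) == odd n) by case: odd; case: odd.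
rewrite if_neg; case: eqVneq => [xn /hasP[z + zS] yS|_ xS /hasPn yS].
  rewrite mem_nbrs => xz; split=> //; apply/negP => xS.
  by move/indepP: iS => /(_ _ _ xS zS); rewrite xz.
by have := yS x; rewrite mem_nbrs /= xS => /(_ yx).
Qed.

Let P_bd x y (xy : adj x y) (Px : wrong_cover n S x) (Py : ~~ wrong_cover n S y) :
  odd (norm1 x) = odd n.
Proof. by have [] := wrong_cover_boundary xy Px Py. Qed.

Lemma contour_of_closed K : closed_in n (wrong_cover n S) K ->
  is_contour n K /\ clear_along K S.
Proof.
pose P := wrong_cover n S; move=> cK; have e2P := fun x => inside_e2 wrong_cover_fin P_bd x cK.
have jK x : x \in K -> P x != P (x + e1).
  by case: cK => KH _ /KH; rewrite (mem_jumps wrong_cover_fin) -/P; case: (P _); case: (P _).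
have e1P x : inside K x != inside K (x + e1) -> P x != P (x + e1).
  by move=> xx; apply: jK; move: xx; rewrite inside_e1; case: (x \in K); case: inside.
have e2P' x : inside K x != inside K (x + e2) -> P x != P (x + e2).
  by have := e2P x; rewrite -/P; case: inside; case: inside; case: (P _); case: (P _).
split.
  split=> [x|x E1 E2]; first exact: (inside_fin wrong_cover_fin P_bd).
  apply/eqP/negPn/negP => xx.
  have xK : x \in K by move: xx; rewrite inside_e1; case: (x \in K); case: inside.
  have x2K : x + e2 \in K.
    move: xx; rewrite E1 E2 (inside_e1 K (x + e2)) (addrAC x e2).
    by case: (x + e2 \in K); case: inside.
  have := e2P x; rewrite E1 addbb xK andbT -/P => P2.
  have := jK _ x2K; have := jK _ xK; rewrite (addrAC x e2) => Px Px2.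
  move/negP: (Px); apply; apply/eqP; apply: (not_flat_v P_bd); rewrite -/P.
    by move: P2; case: (P _); case: (P _).
  by move: P2 Px Px2; case: (P x); case: (P (x + e2)); case: (P (x + e1)); case: (P _).
move=> x y xy xI yI.
suff : P x != P y.
  case: (boolP (P x)) => Px; case: (boolP (P y)) => Py //= _.
    by have [_] := wrong_cover_boundary xy Px Py.
  by rewrite adjC in xy; have [_] := wrong_cover_boundary xy Py Px.
have xyI : inside K x != inside K y by rewrite xI (negbTE yI).
move: xy; rewrite -mem_nbrs nbrsE !inE => /or4P[]/eqP yx; rewrite yx in xyI *.
- exact: e1P.
- by rewrite eq_sym -{2}(subrK e1 x); apply: e1P; rewrite subrK eq_sym.
- exact: e2P'.
- by rewrite eq_sym -{2}(subrK e2 x); apply: e2P'; rewrite subrK eq_sym.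
Qed.

(** The ray from [u] to the right meets the contour at distance [t]. As [u] is inside a
    bounded region, the contour also has a point to the left of [u], and a walk
    through all its points has to make up this distance. *)
Lemma contour_around u : u \in S -> odd (norm1 u) != odd n ->
  exists K : {fset plane}, exists t : nat, exists w : seq step,
    [/\ is_contour n K, clear_along K S, (t < 2 * #|` K|)%N, size w = (2 * #|` K|)%N &
        trace (u.1 + t%:Z, u.2) w =i K].
Proof.
move=> uS un; have Pu : wrong_cover n S u by rewrite /wrong_cover (negbTE un).
have [K [cK uK iK]] := irreducible_around wrong_cover_fin Pu.
have [ctK clK] := contour_of_closed cK.
have : exists a, a \in ray K u.
  by apply/fset0Pn; rewrite -cardfs_gt0; move: uK; rewrite /inside; case: #|` _|.
move=> [a]; rewrite mem_ray => /and3P[aK /eqP au ua].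
have [w sw Ew] := irreducible_trace cK iK aK.
have aE : a = (u.1 + (absz (a.1 - u.1)%R)%:Z, u.2).
  by clear -au ua; apply/eqP; move: au ua; plane_lia.
exists K, (absz (a.1 - u.1)%R), w; split=> //; last by rewrite -aE.
(* A point of the contour lies strictly to the left of u. *)
have [b bK bu] : exists2 b, b \in K & b.1 < u.1.
  have : ~ forall s : nat, inside K (u.1 - s%:Z, u.2).
    by move=> /(_ (n + `|u.1|).+1%N); case: ctK => + _ => /[apply]; clear; plane_lia.
  move=> /existsNP[s]; elim: s => [|s IHs] us.
    by case: us; rewrite subr0 -surjective_pairing.
  case: (boolP (inside K (u.1 - s%:Z, u.2))) => us'; last by apply: IHs; apply/negP.
  exists (u.1 - s.+1%:Z, u.2); last by rewrite /=; lia.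
  have := inside_e1 K (u.1 - s.+1%:Z, u.2).
  have -> : (u.1 - s.+1%:Z, u.2) + e1 = (u.1 - s%:Z, u.2).
    by apply/eqP; clear; plane_lia.
  by rewrite us'; move/negP/negbTE: us => ->; case: (_ \in K).
rewrite -sw; have := trace_column (z := a) (w := w) (y := b).
by rewrite Ew bK => /(_ isT); move: ua bu; clear; plane_lia.
Qed.

End WrongCover.

(** * The Peierls estimate *)

Lemma ler_sum_inj (R : realFieldType) (I : eqType) (s : seq I) (A B : pred I)
    (f : I -> I) (v w : I -> R) :
  uniq s -> (forall x, 0 <= w x) ->
  {in s, forall x, A x -> [/\ f x \in s, B (f x) & v x <= w (f x)]} ->
  {in s &, forall x y, A x -> A y -> f x = f y -> x = y} ->
  \sum_(x <- s | A x) v x <= \sum_(x <- s | B x) w x.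
Proof.
move=> us w0 fAB finj.
have le1 : \sum_(x <- s | A x) v x <= \sum_(x <- s | A x) w (f x).
  rewrite big_seq_cond [X in _ <= X]big_seq_cond; apply: ler_sum => x /andP[xs Ax].
  by have [] := fAB x xs Ax.
apply: le_trans le1 _; rewrite -big_filter -(big_map f xpredT).
set t := map _ _.
have ut : uniq t.
  rewrite map_inj_in_uniq ?filter_uniq // => x y.
  by rewrite !mem_filter => /andP[Ax xs] /andP[Ay ys]; exact: finj.
have ts y : y \in t -> (y \in s) && B y.
  move=> /mapP[x + ->]; rewrite mem_filter => /andP[Ax xs].
  by have [-> ->] := fAB x xs Ax.
rewrite -(big_filter s) [X in _ <= X](bigID (mem t)) /=.
rewrite -[X in _ <= X + _]big_filter.
have tE : perm_eq [seq i <- [seq x <- s | B x] | i \in t] t.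
  apply: uniq_perm; rewrite ?filter_uniq // => y; rewrite !mem_filter.
  by apply/andb_idr => /ts; rewrite andbC.
by rewrite (perm_big _ tE) lerDl sumr_ge0.
Qed.

Lemma ler_sum_union (R : realFieldType) (T : eqType) (s : seq T) (I : finType)
    (A : pred T) (B : I -> pred T) (w : T -> R) :
  (forall x, 0 <= w x) -> {in s, forall x, A x -> exists i, B i x} ->
  \sum_(x <- s | A x) w x <= \sum_i \sum_(x <- s | B i x) w x.
Proof.
move=> w0 AB; under [X in _ <= X]eq_bigr do rewrite big_mkcond.
rewrite exchange_big /= big_mkcond /= big_seq [X in _ <= X]big_seq.
apply: ler_sum => x xs; case: ifP => [Ax|_]; last first.
  by apply: sumr_ge0 => i _; case: ifP.
have [i Bix] := AB x xs Ax; rewrite (bigD1 i) //= Bix lerDl.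
by apply: sumr_ge0 => j _; case: ifP.
Qed.

Section Sums.
Variables (R : realFieldType) (lam : R).
Hypothesis lam_gt0 : 0 < lam.

(** The unnormalised weight of the event [Q] in the hard-core model with activity
    [lam] on the diamond. *)
Definition hardcore_sum n (Q : pred {fset plane}) : R :=
  \sum_(S <- fpowerset (diamond n) | indep S && Q S) lam ^+ #|` S|.

Lemma hardcore_sum_ge0 n Q : 0 <= hardcore_sum n Q.
Proof. by apply: sumr_ge0 => S _; rewrite exprn_ge0 // ltW. Qed.

Lemma hardcore_sum_gt0 n : 0 < hardcore_sum n predT.
Proof.
rewrite /hardcore_sum big_mkcond (bigD1_seq fset0) ?fpowersetE ?fsub0set ?fset_uniq //.
have i0 : indep fset0 by apply/indepP.
rewrite i0 cardfs0 expr0 /=.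
rewrite ltr_pwDl // sumr_ge0 // => S _; case: ifP => // _.
by rewrite exprn_ge0 // ltW.
Qed.

Lemma hardcore_sum_shift n (Q Q' : pred {fset plane}) (f : {fset plane} -> {fset plane}) k :
  (forall S : {fset plane}, {subset S <= diamond n} -> indep S -> Q S ->
     [/\ {subset f S <= diamond n}, indep (f S), Q' (f S) & #|` f S| = (#|` S| + k)%N]) ->
  (forall S S' : {fset plane}, {subset S <= diamond n} -> {subset S' <= diamond n} ->
     Q S -> Q S' -> f S = f S' -> S = S') ->
  lam ^+ k * hardcore_sum n Q <= hardcore_sum n Q'.
Proof.
move=> fP finj; rewrite /hardcore_sum big_distrr /=.
apply: (@ler_sum_inj _ _ _ _ _ f); first exact: fset_uniq.
- by move=> S; rewrite exprn_ge0 // ltW.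
- move=> S; rewrite fpowersetE => /fsubsetP Sn /andP[iS QS].
  have [fSn ifS Q'S cS] := fP S Sn iS QS; split.
  + by rewrite fpowersetE; apply/fsubsetP.
  + by rewrite ifS.
  + by rewrite cS exprD mulrC.
move=> S S'; rewrite !fpowersetE => /fsubsetP Sn /fsubsetP S'n /andP[_ QS] /andP[_ QS'].
exact: finj.
Qed.

Lemma hardcore_sum_union n (I : finType) (Q : pred {fset plane}) (Qi : I -> pred {fset plane}) :
  (forall S : {fset plane}, {subset S <= diamond n} -> indep S -> Q S -> exists i, Qi i S) ->
  hardcore_sum n Q <= \sum_i hardcore_sum n (Qi i).
Proof.
move=> QQ; apply: ler_sum_union => [S|S]; first by rewrite exprn_ge0 // ltW.
rewrite fpowersetE => /fsubsetP Sn /andP[iS QS].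
by have [i QiS] := QQ S Sn iS QS; exists i; rewrite iS.
Qed.

Lemma hardcore_sum_le n (Q Q' : pred {fset plane}) :
  (forall S : {fset plane}, {subset S <= diamond n} -> indep S -> Q S -> Q' S) ->
  hardcore_sum n Q <= hardcore_sum n Q'.
Proof.
move=> QQ; rewrite -[X in X <= _]mul1r -(expr0 lam).
apply: (hardcore_sum_shift (f := id)) => [S Sn iS QS|//].
by rewrite addn0; split => //; exact: QQ.
Qed.

Definition has_contour n K m (S : {fset plane}) : bool :=
  `[< [/\ is_contour n K, clear_along K S & #|` left_rim n K| = m] >].

(** The shift is injective and gains one particle for each site of the left rim. *)
Lemma hardcore_sum_contour n K m :
  hardcore_sum n (has_contour n K m) <= lam ^- m * hardcore_sum n predT.
Proof.
rewrite -ler_pdivrMl ?invr_gt0 ?exprn_gt0 // invrK.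
have [[cK mK]|nK] := EM (is_contour n K /\ #|` left_rim n K| = m); last first.
  rewrite [hardcore_sum n _]big_pred0 ?mulr0 ?hardcore_sum_ge0 // => S.
  by apply/negP => /andP[_ /asboolP[cK _ mK]]; apply: nK.
apply: (hardcore_sum_shift (f := shift n K)).
  move=> S Sn iS /asboolP[_ clS _]; split=> //; first exact: shift_sub.
    exact: shift_indep.
  by rewrite card_shift // mK.
by move=> S S' Sn S'n /asboolP[_ clS _] /asboolP[_ clS' _]; exact: shift_inj.
Qed.

Definition trace_set (z : plane) (w : seq step) : {fset plane} := [fset x in trace z w]%fset.

(** Union bound over contours, coded by the size [m] of their left rim, the abscissa
    of the starting point of a walk, and its [4 m] steps. *)
Lemma peierls_sum n u : odd (norm1 u) != odd n ->
  hardcore_sum n (fun S => u \in S) <=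
  \sum_(m < #|` diamond n|.+1) ((4 * m) * 9 ^ (4 * m))%:R * lam ^- m * hardcore_sum n predT.
Proof.
move=> un.
(* The three components of the code are summed over one after the other. *)
pose Q3 (m : 'I_(#|` diamond n|.+1)) (t : 'I_(4 * m)) (w : (4 * m).-tuple step) :=
  has_contour n (trace_set (u.1 + t%:Z, u.2) w) m.
pose Q2 (m : 'I_(#|` diamond n|.+1)) (t : 'I_(4 * m)) S := [exists w, Q3 m t w S].
pose Q1 (m : 'I_(#|` diamond n|.+1)) S := [exists t, Q2 m t S].
apply: (@le_trans _ _ (\sum_m hardcore_sum n (Q1 m))).
  apply: hardcore_sum_union => S Sn iS uS.
  have [K [t [w [cK clK tK sw Ew]]]] := contour_around Sn iS uS un.
  have TE : trace_set (u.1 + t%:Z, u.2) w = K by apply/fsetP => x; rewrite in_fset Ew.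
  have mK : (#|` left_rim n K| < #|` diamond n|.+1)%N.
    by rewrite ltnS fsubset_leq_card //; apply/fsubsetP => x; rewrite !inE => /andP[].
  have K4 : (2 * #|` K| = 4 * Ordinal mK)%N by rewrite (card_contour cK) /= mulnA.
  rewrite K4 in tK sw; exists (Ordinal mK); apply/existsP; exists (Ordinal tK).
  have sw' : size w == (4 * Ordinal mK)%N by rewrite sw.
  apply/existsP; exists (Tuple sw'); apply/asboolP.
  by split; rewrite /= TE.
apply: ler_sum => m _.
have -> : ((4 * m) * 9 ^ (4 * m))%:R * lam ^- m * hardcore_sum n predT =
    \sum_(t < 4 * m) \sum_(w : (4 * m).-tuple step) lam ^- m * hardcore_sum n predT.
  rewrite !sumr_const card_tuple card_ord !card_prod !card_ord -mulrnA.
  by rewrite -mulrA mulrC mulr_natr mulnC.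
apply: (@le_trans _ _ (\sum_t hardcore_sum n (Q2 m t))).
  by apply: hardcore_sum_union => S _ _ /existsP.
apply: ler_sum => t _; apply: (@le_trans _ _ (\sum_w hardcore_sum n (Q3 m t w))).
  by apply: hardcore_sum_union => S _ _ /existsP.
by apply: ler_sum => w _; exact: hardcore_sum_contour.
Qed.

Lemma sum_geometric_le2 (x : R) M : 0 <= x <= 2^-1 -> \sum_(i < M) x ^+ i <= 2.
Proof.
move=> /andP[x0 x1]; elim: M => [|M IHM]; first by rewrite big_ord0.
rewrite big_ord_recl expr0; under eq_bigr do rewrite lift0 exprS.
by rewrite -mulr_sumr; nra.
Qed.

(** For [m] positive [4 m <= 4 ^ m], so the sum over contours is at most the geometric
    series of ratio [4 * 9 ^ 4 / lam]. *)
Lemma peierls n u : odd (norm1 u) != odd n -> 2 * (4 * 9 ^+ 4) <= lam ->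
  lam * hardcore_sum n (fun S => u \in S) <= 2 * (4 * 9 ^+ 4) * hardcore_sum n predT.
Proof.
set C : R := 4 * 9 ^+ 4 => un lamC.
have C0 : 0 < C by rewrite mulr_gt0 // exprn_gt0.
have x01 : 0 <= C / lam <= 2^-1.
  apply/andP; split; first by rewrite divr_ge0 // ltW.
  by rewrite ler_pdivrMr // mulrC ler_pdivlMr // mulrC.
rewrite -ler_pdivlMl // mulrA; apply: le_trans (peierls_sum un) _.
rewrite -mulr_suml; apply: ler_wpM2r; first exact: hardcore_sum_ge0.
rewrite big_ord_recl /= muln0 mul0n mul0r add0r.
apply: (@le_trans _ _ (\sum_(i < #|` diamond n|) (C / lam) * (C / lam) ^+ i)).
  apply: ler_sum => i _; rewrite /bump leq0n add1n -exprS exprMn exprVn.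
  apply: ler_wpM2r; first by rewrite invr_ge0 exprn_ge0 // ltW.
  rewrite /C exprMn -exprM -!natrX -natrM ler_nat leq_mul2r; apply/orP; right.
  elim: (nat_of_ord i) => // k IHk; rewrite expnS; lia.
rewrite -mulr_sumr; have := sum_geometric_le2 #|` diamond n| x01.
case/andP: x01 => x0 _ /(ler_wpM2l x0) /le_trans; apply.
by rewrite mulrC mulrA mulrC.
Qed.

End Sums.

(** * The two phases *)

Section Phases.
Variables (R : realFieldType) (lam : R).
Hypothesis lam_gt0 : 0 < lam.

Lemma hardcore_sum_or n (Q Q1 Q2 : pred {fset plane}) : (forall S, Q S -> Q1 S || Q2 S) ->
  hardcore_sum lam n Q <= hardcore_sum lam n Q1 + hardcore_sum lam n Q2.
Proof.
move=> QQ; have := @hardcore_sum_union _ _ lam_gt0 n bool Q (fun b => if b then Q1 else Q2).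
rewrite big_bool; apply=> S _ _ /QQ /orP[QS|QS]; by [exists true|exists false].
Qed.

Lemma hardcore_sum_has n (I : Type) (s : seq I) (Q : I -> pred {fset plane}) :
  hardcore_sum lam n (fun S => has (Q^~ S) s) <= \sum_(i <- s) hardcore_sum lam n (Q i).
Proof.
elim: s => [|i s IHs]; first by rewrite big_nil /hardcore_sum big_pred0 // => S; rewrite andbF.
rewrite big_cons; apply: le_trans (lerD (lexx _) IHs).
by apply: hardcore_sum_or => S.
Qed.

(** A vacant site without occupied neighbours could be occupied, which multiplies the
    weight by [lam]. *)
Lemma hardcore_sum_addable n v : v \in diamond n ->
  lam * hardcore_sum lam n (fun S => (v \notin S) && ~~ has (mem S) (nbrs v)) <=
  hardcore_sum lam n predT.
Proof.
move=> vn; rewrite -{1}(expr1 lam).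
apply: (hardcore_sum_shift lam_gt0 (f := fun S => (v |` S)%fset)).
  move=> S Sn /indepP iS /andP[vS /hasPn nS]; split=> //.
  - by move=> x; rewrite in_fset1U => /predU1P[->|/Sn].
  - have vx x : x \in S -> adj v x = false.
      move=> xS; apply/negP => vx; have := nS x; rewrite mem_nbrs /= xS.
      by move/(_ vx).
    apply/indepP => x y; rewrite !in_fset1U => /predU1P[->|xS] /predU1P[->|yS].
    + by clear; plane_lia.
    + exact: vx.
    + by rewrite adjC vx.
    + exact: iS.
  - by rewrite cardfsU1 vS addnC.
move=> S S' _ _ /andP[vS _] /andP[vS' _] E; apply/fsetP => x.
have := congr1 (fun A : {fset plane} => x \in A) E; rewrite !in_fset1U.
by case: eqVneq => [->|//]; rewrite (negbTE vS) (negbTE vS').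
Qed.

Let C : R := 2 * (4 * 9 ^+ 4).

Let C_gt0 : 0 < C. Proof. by rewrite /C !mulr_gt0 // exprn_gt0. Qed.

(** A site of the right parity is vacant either because of an occupied neighbour, which
    is a wrong particle, or although it could be occupied. *)
Lemma hardcore_sum_missing n v : (norm1 v <= n)%N -> odd (norm1 v) = odd n -> C <= lam ->
  lam * hardcore_sum lam n (fun S => v \notin S) <= (4 * C + 1) * hardcore_sum lam n predT.
Proof.
move=> vn pv lamC; rewrite mulrDl mul1r.
have h1 : hardcore_sum lam n (fun S => v \notin S) <=
    \sum_(x <- nbrs v) hardcore_sum lam n (fun S => x \in S) +
    hardcore_sum lam n (fun S => (v \notin S) && ~~ has (mem S) (nbrs v)).
  apply: le_trans (lerD (@hardcore_sum_has n _ (nbrs v) (fun x S => x \in S)) (lexx _)).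
  by apply: hardcore_sum_or => S ->; rewrite orbN.
apply: le_trans (ler_wpM2l (ltW lam_gt0) h1) _; rewrite mulrDr lerD //; last first.
  by apply: hardcore_sum_addable; rewrite mem_diamond.
rewrite mulr_sumr.
have -> : 4 * C * hardcore_sum lam n predT =
    \sum_(x <- nbrs v) C * hardcore_sum lam n predT.
  by rewrite nbrsE !big_cons big_nil; ring.
rewrite big_seq [X in _ <= X]big_seq; apply: ler_sum => x; rewrite mem_nbrs => vx.
by apply: peierls => //; rewrite (adj_norm1 vx) pv; case: odd.
Qed.

(** Each of the four sites around the origin is missing with probability at most
    [(4 C + 1) / lam] in the favourable phase; the factor 16 makes their sum at most
    one quarter. *)
Definition phase_threshold : R := 16 * (4 * C + 1).

(** On this event the origin decides between an image that contains the whole cross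
    and one that is empty there. *)
Definition surrounded (S : {fset plane}) : bool := all (mem S) (nbrs 0).

Hypothesis lam_large : phase_threshold <= lam.

Let lamC : 16 * (4 * C + 1) <= lam. Proof. exact: lam_large. Qed.

Lemma surrounded_rare n : ~~ odd n ->
  4 * hardcore_sum lam n surrounded <= hardcore_sum lam n predT.
Proof.
move=> on; have lamC' : C <= lam by move: lamC C_gt0; lra.
have := @peierls _ lam lam_gt0 n e1 _ lamC'; rewrite (negbTE on) => /(_ isT) hp.
have : hardcore_sum lam n surrounded <= hardcore_sum lam n (fun S => e1 \in S).
  by apply: hardcore_sum_le => // S _ _ /allP; apply; rewrite mem_nbrs.
move: hp (hardcore_sum_ge0 lam_gt0 n predT) lamC C_gt0; rewrite -/C.
move: (hardcore_sum lam n predT) (hardcore_sum _ _ surrounded) (hardcore_sum _ _ _) => Z Zs Z1.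
move=> h1 h2 h3 h4 h5; rewrite -(ler_pM2l lam_gt0); nra.
Qed.

Lemma surrounded_likely n : odd n ->
  3 * hardcore_sum lam n predT <= 4 * hardcore_sum lam n surrounded.
Proof.
move=> on; have lamC' : C <= lam by move: lamC C_gt0; lra.
have h1 : hardcore_sum lam n predT <= hardcore_sum lam n surrounded +
    \sum_(v <- nbrs 0) hardcore_sum lam n (fun S => v \notin S).
  apply: le_trans (lerD (lexx _) (@hardcore_sum_has n _ (nbrs 0) (fun x S => x \notin S))).
  by apply: hardcore_sum_or => S _; rewrite /surrounded -(negbK (all _ _)) -has_predC orbC orbN.
have h2 : lam * \sum_(v <- nbrs 0) hardcore_sum lam n (fun S => v \notin S) <=
    4 * ((4 * C + 1) * hardcore_sum lam n predT).
  rewrite mulr_sumr; have -> : 4 * ((4 * C + 1) * hardcore_sum lam n predT) =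
      \sum_(v <- nbrs 0) (4 * C + 1) * hardcore_sum lam n predT.
    by rewrite nbrsE !big_cons big_nil; ring.
  rewrite big_seq [X in _ <= X]big_seq; apply: ler_sum => v; rewrite mem_nbrs => v0.
  have v1 : norm1 v = 1%N by move: v0; clear; plane_lia.
  by apply: hardcore_sum_missing => //; rewrite v1 ?on ?odd_gt0.
move: h1 h2 (hardcore_sum_ge0 lam_gt0 n predT) lamC C_gt0.
move: (hardcore_sum lam n predT) (hardcore_sum _ _ surrounded) (\sum_(v <- _) _) => Z Zs Z1.
move=> h1 h2 h3 h4 h5; rewrite -(ler_pM2l lam_gt0).
nra.
Qed.

End Phases.

(** * A plane inside the lattice *)

Lemma thinE d (w : config d) x : thin w x = w x && has w (neighbours x).
Proof.
rewrite /thin; congr andb; elim: (neighbours x) => [|y s IHs]; first by rewrite big_nil.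
by rewrite big_cons /= negb_and negbK IHs.
Qed.

Section Plane.
Variable d : nat.
Notation site := (site d.+2).

Definition transverse (i : 'I_d) : 'I_d.+2 := lift ord0 (lift ord0 i).
Definition planar (z : site) : plane := (z 0 ord0, z 0 (lift ord0 ord0)).
Definition height (z : site) : nat := (\sum_(i < d) `|(z 0 (transverse i))%R|)%N.
Definition embed (a : plane) : site :=
  \row_j (if j == ord0 then a.1 else if j == lift ord0 ord0 then a.2 else 0).
(** The distance in the sum norm to the diamond of radius [n] in the plane. *)
Definition diamond_dist n (z : site) : nat := (height z + (norm1 (planar z) - n))%N.

Lemma planar_embed a : planar (embed a) = a.
Proof. by case: a => a1 a2; rewrite /planar !mxE. Qed.

Lemma height_embed a : height (embed a) = 0%N.
Proof. by rewrite /height big1 // => i _; rewrite mxE. Qed.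

Lemma ord_plane (i : 'I_d.+2) : [\/ i = ord0, i = lift ord0 ord0 | exists j, i = transverse j].
Proof.
case: (unliftP ord0 i) => [j ->|->]; last by constructor 1.
by case: (unliftP ord0 j) => [k ->|->]; [constructor 3; exists k|constructor 2].
Qed.

Lemma embed_planar z : height z = 0%N -> embed (planar z) = z.
Proof.
move=> /eqP; rewrite /height sum_nat_eq0 => /forallP z0.
apply/rowP => i; rewrite mxE; case: (ord_plane i) => [->|->|[j ->]] //=.
by have := z0 j; rewrite implyTb absz_eq0 => /eqP ->.
Qed.

Lemma moveE (z : site) (s : int) k i :
  (z + s *: delta_mx 0 k) 0 i = z 0 i + (if i == k then s else 0).
Proof. by rewrite !mxE eqxx /= mulr_natr; case: eqVneq; rewrite ?mulr1n ?mulr0n. Qed.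

Lemma neighboursP (x y : site) :
  reflect (exists k s, (s = 1 \/ s = -1) /\ y = x + s *: delta_mx 0 k) (y \in neighbours x).
Proof.
apply: (iffP allpairsP) => [[[k s] /= [_ ss ->]]|[k [s [ss ->]]]].
  by exists k, s; split=> //; move: ss; rewrite !inE => /orP[]/eqP->; [left|right].
exists (k, s); rewrite mem_enum /= !inE; split=> //.
by case: ss => ->; rewrite eqxx ?orbT.
Qed.

Lemma neighbours_sym (x y : site) : (y \in neighbours x) = (x \in neighbours y).
Proof.
have sym (u v : site) : v \in neighbours u -> u \in neighbours v.
  move=> /neighboursP[k [s [ss ->]]]; apply/neighboursP; exists k, (- s).
  by rewrite scaleNr addrK; split=> //; case: ss => ->; rewrite ?opprK; [right|left].
by apply/idP/idP; exact: sym.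
Qed.

Lemma planar_move0 (z : site) s : planar (z + s *: delta_mx 0 ord0) = planar z + (s, 0).
Proof. by rewrite /planar !moveE. Qed.

Lemma planar_move1 (z : site) s : planar (z + s *: delta_mx 0 (lift ord0 ord0)) = planar z + (0, s).
Proof. by rewrite /planar !moveE. Qed.

Lemma planar_move2 (z : site) s j : planar (z + s *: delta_mx 0 (transverse j)) = planar z.
Proof. by rewrite /planar !moveE !addr0. Qed.

Lemma height_move0 (z : site) s : height (z + s *: delta_mx 0 ord0) = height z.
Proof. by apply: eq_bigr => i _; rewrite moveE addr0. Qed.

Lemma height_move1 (z : site) s : height (z + s *: delta_mx 0 (lift ord0 ord0)) = height z.
Proof. by apply: eq_bigr => i _; rewrite moveE (inj_eq lift_inj) addr0. Qed.

Lemma height_move2 (z : site) s j :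
  (height (z + s *: delta_mx 0 (transverse j))%R + `|(z 0 (transverse j))%R| =
   height z + `|(z 0 (transverse j) + s)%R|)%N.
Proof.
rewrite /height (bigD1 j) //= [in RHS](bigD1 j) //= moveE eqxx.
rewrite (eq_bigr (fun i => `|(z 0 (transverse i))%R|%N)) => [|i ij]; first lia.
by rewrite moveE /transverse !(inj_eq lift_inj) (negbTE ij) addr0.
Qed.

Lemma neighbours_planar (x y : site) : y \in neighbours x ->
  (height y = height x /\ adj (planar x) (planar y)) \/
  (planar y = planar x /\ (height y = (height x).+1 \/ height x = (height y).+1)).
Proof.
move=> /neighboursP[k [s [ss ->]]]; case: (ord_plane k) => [->|->|[j ->]].
- left; rewrite height_move0 planar_move0; split=> //; rewrite -mem_nbrs nbrsE !inE.
  by case: ss => ->; rewrite eqxx ?orbT.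
- left; rewrite height_move1 planar_move1; split=> //; rewrite -mem_nbrs nbrsE !inE.
  by case: ss => ->; rewrite eqxx ?orbT.
- right; rewrite planar_move2; split=> //; have := height_move2 x s j.
  move: (height _) (height x) (x 0 _) => r r' a. by case: ss => ->; lia.
Qed.

Lemma plane_neighbour (x : site) b : adj (planar x) b ->
  exists y, [/\ y \in neighbours x, planar y = b & height y = height x].
Proof.
rewrite -mem_nbrs nbrsE !inE => /or4P[]/eqP->.
- exists (x + 1 *: delta_mx 0 ord0); rewrite planar_move0 height_move0; split=> //.
  by apply/neighboursP; exists ord0, 1; split=> //; left.
- exists (x + (-1) *: delta_mx 0 ord0); rewrite planar_move0 height_move0; split=> //.
  by apply/neighboursP; exists ord0, (-1); split=> //; right.
- exists (x + 1 *: delta_mx 0 (lift ord0 ord0)); rewrite planar_move1 height_move1; split=> //.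
  by apply/neighboursP; exists (lift ord0 ord0), 1; split=> //; left.
- exists (x + (-1) *: delta_mx 0 (lift ord0 ord0)); rewrite planar_move1 height_move1; split=> //.
  by apply/neighboursP; exists (lift ord0 ord0), (-1); split=> //; right.
Qed.

Lemma height_neighbours (x : site) : (0 < height x)%N ->
  (exists y, [/\ y \in neighbours x, planar y = planar x & height y = (height x).+1]) /\
  (exists y, [/\ y \in neighbours x, planar y = planar x & (height y).+1 = height x]).
Proof.
rewrite lt0n sum_nat_eq0 => /forallPn[j /=]; rewrite absz_eq0 => xj.
have mem s : s = 1 \/ s = -1 -> x + s *: delta_mx 0 (transverse j) \in neighbours x.
  by move=> ss; apply/neighboursP; exists (transverse j), s.
have [m1 m2] := (mem 1 (or_introl erefl), mem (-1) (or_intror erefl)).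
pose up := x + 1 *: delta_mx 0 (transverse j); pose down := x + (-1) *: delta_mx 0 (transverse j).
have [[ru rd]|[ru rd]] : (height up = (height x).+1 /\ (height down).+1 = height x) \/
                         (height down = (height x).+1 /\ (height up).+1 = height x).
  have := height_move2 x 1 j; have := height_move2 x (-1) j; rewrite -/up -/down.
  by move: (height up) (height down) (height x) (x 0 _) xj => r r' r'' a; lia.
- by split; [exists up|exists down]; rewrite planar_move2.
- by split; [exists down|exists up]; rewrite planar_move2.
Qed.

Lemma norm1_up (a : plane) : exists2 b, adj a b & norm1 b = (norm1 a).+1.
Proof.
case: (lerP 0 a.1) => a1; first by exists (a + e1); move: a1; clear; plane_lia.
by exists (a - e1); move: a1; clear; plane_lia.
Qed.

Lemma norm1_down (a : plane) : (0 < norm1 a)%N -> exists2 b, adj a b & (norm1 b).+1 = norm1 a.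
Proof.
move=> a0; case: (ltrP a.1 0) => a1.
  by exists (a + e1); move: a0 a1; clear; plane_lia.
case: (ltrP 0 a.1) => a1'.
  by exists (a - e1); move: a0 a1'; clear; plane_lia.
case: (ltrP a.2 0) => a2.
  by exists (a + e2); move: a0 a2; clear; plane_lia.
by exists (a - e2); move: a0 a1 a1' a2; clear; plane_lia.
Qed.

Lemma diamond_dist_neighbour n (x y : site) :
  y \in neighbours x -> (diamond_dist n y <= (diamond_dist n x).+1)%N.
Proof.
rewrite /diamond_dist => /neighbours_planar[[-> xy]|[->]]; last lia.
have : (norm1 (planar y) <= (norm1 (planar x)).+1)%N.
  by move: (planar x) (planar y) xy; clear; plane_lia.
lia.
Qed.

Lemma diamond_dist_up n (x : site) : (0 < diamond_dist n x)%N ->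
  exists2 y, y \in neighbours x & diamond_dist n y = (diamond_dist n x).+1.
Proof.
rewrite /diamond_dist => x0; case: (ltnP n (norm1 (planar x))) => xn.
  have [b xb nb] := norm1_up (planar x); have [y [yx yb ry]] := plane_neighbour xb.
  by exists y; rewrite // yb ry nb; lia.
have [|[y [yx py ry]] _] := @height_neighbours x; first lia.
by exists y; rewrite // py ry; lia.
Qed.

Lemma diamond_dist_down n (x : site) : (0 < diamond_dist n x)%N ->
  exists2 y, y \in neighbours x & (diamond_dist n y).+1 = diamond_dist n x.
Proof.
rewrite /diamond_dist => x0; case: (ltnP n (norm1 (planar x))) => xn.
  have [|b xb nb] := @norm1_down (planar x); first lia.
  have [y [yx yb ry]] := plane_neighbour xb.
  by exists y; rewrite // yb ry; lia.
have [|_ [y [yx py ry]]] := @height_neighbours x; first lia.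
by exists y; rewrite // py; lia.
Qed.

Lemma diamond_dist_eq0 n x :
  (diamond_dist n x == 0%N) = (height x == 0%N) && (norm1 (planar x) <= n)%N.
Proof. by rewrite /diamond_dist addn_eq0 subn_eq0. Qed.

Lemma ball_fset n m : {B : {fset site} | forall x, (x \in B) = (diamond_dist n x <= m)%N}.
Proof.
pose N := (n + m)%N.
pose f (g : {ffun 'I_d.+2 -> 'I_(2 * N).+1}) : site := \row_j ((g j)%:Z - N%:Z).
exists [fset x in codom f | (diamond_dist n x <= m)%N]%fset => x.
rewrite in_fset; apply/andb_idl => xm; apply/codomP.
exists [ffun j => inord (absz (x 0 j + N%:Z)%R)]; apply/rowP => j.
have xj : (`|(x 0 j)%R| <= N)%N.
  move: xm; rewrite /diamond_dist /norm1 /planar /= /N.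
  case: (ord_plane j) => [->|->|[k ->]]; [lia|lia|].
  by rewrite /height (bigD1 k) //=; lia.
by rewrite mxE ffunE inordK; lia.
Qed.

End Plane.

(** * Images that freeze everything but a diamond *)

Section Patterns.
Variable d : nat.
Notation site := (site d.+2).

Definition cross : {fset site} := sval (ball_fset d 1 0).

Lemma mem_cross x : (x \in cross) = (height x == 0%N) && (norm1 (planar x) <= 1)%N.
Proof. by rewrite (svalP (ball_fset d 1 0)) leqn0 diamond_dist_eq0. Qed.

Definition window n : {fset site} := sval (ball_fset d n (n + 3)).

Lemma mem_window n x : (x \in window n) = (diamond_dist n x <= n + 3)%N.
Proof. exact: (svalP (ball_fset d n (n + 3))). Qed.

Definition filled n (S : {fset plane}) (x : site) : bool :=
  (2 <= diamond_dist n x)%N || (diamond_dist n x == 0%N) && (planar x \in S).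

Definition filled_event n S (w : config d.+2) : Prop :=
  forall x, x \in window n -> w x = filled n S x.

(** The cross is exempt: it is the volume in which the specification is evaluated. *)
Definition walled n (w : site -> bool) : Prop :=
  forall x, x \notin cross -> x \in window n -> w x = (2 <= diamond_dist n x)%N.

Lemma diamond_dist_embed n a : (norm1 a <= n)%N -> diamond_dist n (embed d a) = 0%N.
Proof. by rewrite /diamond_dist height_embed planar_embed; lia. Qed.

(** The occupied sites beyond distance one have an occupied neighbour further out, or
    further in for those on the rim of the window; a site of the diamond can only have
    occupied neighbours in the diamond. *)
Lemma thin_filled n S (w : config d.+2) x : {subset S <= diamond n} ->
  filled_event n S w -> x \in window n ->
  thin w x = (2 <= diamond_dist n x)%N ||
    [&& diamond_dist n x == 0%N, planar x \in S & has (mem S) (nbrs (planar x))].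
Proof.
move=> Sn wS xn; rewrite thinE (wS x xn) /filled.
case: (ltnP 1 (diamond_dist n x)) => x2; rewrite ?orTb ?orFb.
  suff : has w (neighbours x) by []; apply/hasP; case: (ltnP (diamond_dist n x) (n + 3)) => xn3.
    have [|y yx ydist] := @diamond_dist_up d n x; first lia.
    by exists y => //; rewrite wS ?mem_window ?ydist //; rewrite /filled ydist; lia.
  have [|y yx ydist] := @diamond_dist_down d n x; first lia.
  by rewrite mem_window in xn; exists y; rewrite // wS ?mem_window /filled; lia.
case: eqVneq => [x0|_]; rewrite ?andTb ?andFb //.
case: (boolP (planar x \in S)) => xS; rewrite ?andTb ?andFb //.
have [rx px] : height x = 0%N /\ (norm1 (planar x) <= n)%N.
  by move/eqP: x0; rewrite diamond_dist_eq0 => /andP[/eqP].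
apply/hasP/hasP => -[y yx wy].
  have y1 : (diamond_dist n y <= 1)%N by have := diamond_dist_neighbour n yx; rewrite x0.
  move: wy; rewrite wS ?mem_window ?(leq_trans y1) ?addn3 // /filled ltnNge y1 /=.
  move=> /andP[/eqP y0 yS]; exists (planar y) => //; rewrite mem_nbrs.
  case: (neighbours_planar yx) => [[]//|[_]].
  by move/eqP: y0; rewrite diamond_dist_eq0 => /andP[/eqP -> _]; rewrite rx; lia.
rewrite mem_nbrs in yx; have [z [zx zy rz]] := plane_neighbour yx.
have yn : (norm1 y <= n)%N by rewrite -mem_diamond Sn.
have z0 : diamond_dist n z = 0%N by apply/eqP; rewrite diamond_dist_eq0 zy rz rx yn.
by exists z; rewrite // wS ?mem_window ?z0 // /filled z0 zy /= in wy *.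
Qed.

Definition trace_on_plane n (w : config d.+2) : {fset plane} :=
  [fset a in diamond n | w (embed d a)]%fset.

Lemma trace_sub n w : {subset trace_on_plane n w <= diamond n}.
Proof. by move=> a; rewrite !inE => /andP[]. Qed.

(** At distance one a particle would have an occupied neighbour at distance two and
    survive the thinning; hence these sites are vacant and [S] is decoupled from the
    rest. *)
Lemma walled_filled n (w : config d.+2) : (0 < n)%N -> walled n (thin w) ->
  filled_event n (trace_on_plane n w) w.
Proof.
move=> n0 ww x xn; rewrite /filled.
have nL y : (0 < diamond_dist n y)%N -> y \notin cross.
  by rewrite /diamond_dist; apply: contraTN; rewrite mem_cross => /andP[/eqP -> ?]; lia.
case: (ltngtP (diamond_dist n x) 1) => x1.
- have {}x1 : diamond_dist n x = 0%N by lia.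
  rewrite x1 /=; move/eqP: x1; rewrite diamond_dist_eq0 => /andP[/eqP rx px].
  by rewrite !inE mem_diamond px embed_planar.
- by have := ww x (nL x (ltnW x1)) xn; rewrite x1 thinE => /andP[].
- rewrite x1 /=; apply/negbTE/negP => wx.
  have := ww x (nL x _) xn; rewrite x1 thinE wx /= => /(_ isT) /hasPn.
  have [|y yx ydist] := @diamond_dist_up d n x; first by rewrite x1.
  move=> /(_ y yx)/negP; apply; rewrite x1 in ydist.
  have yn : y \in window n by rewrite mem_window ydist; lia.
  have := ww y (nL y _) yn; rewrite ydist => /(_ isT).
  by rewrite thinE => /andP[].
Qed.

Lemma embed_window n a : (norm1 a <= n)%N -> embed d a \in window n.
Proof. by move=> an; rewrite mem_window diamond_dist_embed. Qed.

Lemma mem_cross_embed a : (embed d a \in cross) = (norm1 a <= 1)%N.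
Proof. by rewrite mem_cross height_embed planar_embed eqxx. Qed.

Lemma walled_indep n (w : config d.+2) x y : (0 < n)%N -> walled n (thin w) ->
  x \in trace_on_plane n w -> y \in trace_on_plane n w -> (1 < norm1 x)%N -> adj x y = false.
Proof.
move=> n0 ww xS yS x1; apply/negP => xy.
have xn : (norm1 x <= n)%N by rewrite -mem_diamond (trace_sub xS).
have := thin_filled (@trace_sub n w) (walled_filled n0 ww) (embed_window xn).
rewrite ww ?embed_window ?mem_cross_embed -?ltnNge // diamond_dist_embed // planar_embed xS /=.
by move=> /esym/hasPn/(_ y); rewrite mem_nbrs xy /= yS => /(_ isT).
Qed.

Lemma walled_subset n (w : config d.+2) : (0 < n)%N -> walled n (thin w) ->
  exists2 S : {fset plane}, {subset S <= diamond n} &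
    indep (S `\` diamond 1)%fset /\ filled_event n S w.
Proof.
move=> n0 ww; exists (trace_on_plane n w); first exact: trace_sub.
split; last exact: walled_filled.
apply/indepP => x y; rewrite !in_fsetD !mem_diamond -!ltnNge => /andP[x1 xS] /andP[_ yS].
exact: (walled_indep n0 ww).
Qed.

(** An empty image on the whole diamond means that all its particles are isolated:
    this is where the hard-core model comes from. *)
Lemma walled_empty n (w : config d.+2) : (0 < n)%N ->
  (walled n (thin w) /\ forall x, x \in cross -> thin w x = false) <->
  exists2 S : {fset plane}, {subset S <= diamond n} & indep S /\ filled_event n S w.
Proof.
move=> n0; split=> [[ww w0]|[S Sn [/indepP iS wS]]].
  exists (trace_on_plane n w); first exact: trace_sub.
  split; last exact: walled_filled.
  apply/indepP => x y xS yS; case: (ltnP 1 (norm1 x)) => x1; first exact: (walled_indep n0 ww).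
  apply/negP => xy; have xn : (norm1 x <= n)%N by lia.
  have := thin_filled (@trace_sub n w) (walled_filled n0 ww) (embed_window xn).
  rewrite w0 ?mem_cross_embed // diamond_dist_embed // planar_embed xS /=.
  by move=> /esym/hasPn/(_ y); rewrite mem_nbrs xy /= yS => /(_ isT).
have tE x : x \in window n -> thin w x = (2 <= diamond_dist n x)%N.
  move=> xn; rewrite (thin_filled Sn wS xn); case: leqP => //= _.
  apply/negP => /and3P[_ xS /hasP[y]]; rewrite mem_nbrs /= => xy yS.
  by move: xy; rewrite iS.
split=> [x _|x]; first exact: tE.
rewrite mem_cross => /andP[/eqP rx px].
have x0 : diamond_dist n x = 0%N by apply/eqP; rewrite diamond_dist_eq0 rx (leq_trans px).
by rewrite tE ?mem_window x0.
Qed.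

(** If the image contains the cross and no other site of the diamond, removing the
    origin leaves a hard-core configuration, and conversely. *)
Lemma walled_full n (w : config d.+2) : (0 < n)%N ->
  (walled n (thin w) /\ forall x, x \in cross -> thin w x = true) <->
  exists2 S : {fset plane}, {subset S <= diamond n} &
    [/\ indep S, surrounded S & filled_event n (0 |` S)%fset w].
Proof.
move=> n0; split=> [[ww w1]|[S Sn [/indepP iS /allP sS wS]]].
  have L1 a : (norm1 a <= 1)%N -> a \in trace_on_plane n w.
    move=> a1; rewrite !inE mem_diamond (leq_trans a1) //=.
    by have := w1 (embed d a); rewrite mem_cross_embed a1 thinE => /(_ isT)/andP[].
  exists (trace_on_plane n w `\ 0)%fset => [x|]; first by rewrite in_fsetD1 => /andP[_ /trace_sub].
  split.
  - apply/indepP => x y; rewrite !in_fsetD1 => /andP[x0 xS] /andP[y0 yS].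
    case: (ltnP 1 (norm1 x)) => x1; first exact: (walled_indep n0 ww).
    case: (ltnP 1 (norm1 y)) => y1; first by rewrite adjC; apply: (walled_indep n0 ww).
    by apply/negP => xy; move: x0 y0 x1 y1 xy; clear; plane_lia.
  - apply/allP => v; rewrite mem_nbrs /= in_fsetD1 => v0; apply/andP.
    split; first by apply/eqP => vE; move: v0; rewrite vE.
    by apply: L1; move: v0; clear; plane_lia.
  - by rewrite fsetD1K; [exact: walled_filled|apply: L1].
have {}sS v : v \in nbrs 0 -> v \in S by exact: sS.
have Tn : {subset (0 |` S)%fset <= diamond n}.
  by move=> x; rewrite in_fset1U => /predU1P[->|/Sn//]; rewrite mem_diamond.
split=> x.
  rewrite mem_cross negb_and -ltnNge => xL xn; rewrite (thin_filled Tn wS xn).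
  case: leqP => //= _; apply/negP => /and3P[]; rewrite diamond_dist_eq0 => /andP[/eqP rx px].
  rewrite rx /= in xL; rewrite in_fset1U => /predU1P[x0|xS]; first by rewrite x0 in xL.
  move=> /hasP[y]; rewrite mem_nbrs /= in_fset1U => xy /predU1P[y0|yS].
    by move: xL xy; rewrite y0; move: (planar x); clear; plane_lia.
  by move: xy; rewrite iS.
rewrite mem_cross => /andP[/eqP rx px].
have x0 : diamond_dist n x = 0%N by apply/eqP; rewrite diamond_dist_eq0 rx (leq_trans px).
rewrite (thin_filled Tn wS) ?mem_window x0 //=.
have [p0|p0] := eqVneq (planar x) 0.
  rewrite p0 in_fset1U eqxx /=; apply/hasP; exists e1; first by rewrite mem_nbrs.
  by rewrite /= in_fset1U sS ?orbT // mem_nbrs.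
have xa : adj 0 (planar x) by move: px p0; move: (planar x); clear; plane_lia.
rewrite in_fset1U (sS (planar x)) ?orbT ?mem_nbrs //=.
by apply/hasP; exists 0; rewrite ?mem_nbrs 1?adjC //= in_fset1U eqxx.
Qed.

End Patterns.

(** * Probabilities of the frozen events *)

(** The factor gained by leaving the five sites of the cross unconstrained; it does
    not depend on the size of the diamond. *)
Definition cross_weight (R : realFieldType) (lam : R) : R :=
  \sum_(T : fpowerset (diamond 1)) lam ^+ #|` val T|.

Lemma hardcore_sum_off_cross (R : realFieldType) (lam : R) n : 0 < lam ->
  \sum_(S <- fpowerset (diamond n) | indep (S `\` diamond 1)%fset) lam ^+ #|` S| <=
  cross_weight lam * hardcore_sum lam n predT.
Proof.
move=> lam0; have w0 (S : {fset plane}) : 0 <= lam ^+ #|` S| by rewrite exprn_ge0 // ltW.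
pose B (T : fpowerset (diamond 1)) (S : {fset plane}) :=
  indep (S `\` diamond 1)%fset && ((S `&` diamond 1)%fset == val T).
apply: le_trans (@ler_sum_union _ _ _ _ _ B _ w0 _) _ => [S _ iS|].
  have SF : (S `&` diamond 1)%fset \in fpowerset (diamond 1) by rewrite fpowersetE fsubsetIr.
  by exists [` SF]%fset; rewrite /B iS /=.
rewrite /cross_weight mulr_suml; apply: ler_sum => T _; rewrite /hardcore_sum big_distrr /=.
apply: (@ler_sum_inj _ _ _ _ _ (fun S : {fset plane} => (S `\` diamond 1)%fset)).
- exact: fset_uniq.
- by move=> S; rewrite mulr_ge0.
- move=> S; rewrite fpowersetE => Sn /andP[iS /eqP ST]; rewrite fpowersetE; split.
  + exact: fsubset_trans (fsubsetDl _ _) Sn.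
  + by rewrite iS.
  + by rewrite -(cardfsID (diamond 1) S) ST exprD.
- move=> S S' _ _ /andP[_ /eqP E] /andP[_ /eqP E'] D.
  by rewrite -(fsetID (diamond 1) S) -(fsetID (diamond 1) S') E E' D.
Qed.

Section Measure.
Context {R : realType} {d : nat}.
Variables (p : R) (mu : probability (config d.+2) R).
Hypotheses (p01 : 0 < p < 1) (mu_p : bernoulli_field p mu).
Notation site := (site d.+2).

Let lam : R := p / (1 - p).
(** The weight of the vacant diamond inside its frozen surroundings. *)
Definition background n : R := \prod_(x <- window d n) bernoulli_pmf p (filled n fset0 x).

Lemma pmf_gt0 b : 0 < bernoulli_pmf p b.
Proof. by case/andP: p01 => p0 p1; case: b; rewrite /= ?subr_gt0. Qed.

Lemma odds_gt0 : 0 < lam.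
Proof. by rewrite divr_gt0 //; [exact: (pmf_gt0 true)|exact: (pmf_gt0 false)]. Qed.

Lemma background_gt0 n : 0 < background n.
Proof. by apply: prodr_gt0 => x _; exact: pmf_gt0. Qed.

Definition filled_set n S : set (config d.+2) := [set w | filled_event n S w].

Lemma measurable_site (x : site) b : measurable [set w : config d.+2 | w x = b].
Proof. by apply: sub_sigma_algebra; exists x => //; exists [set b]; rewrite ?setTI. Qed.

Lemma measurable_filled n S : measurable (filled_set n S).
Proof.
have -> : filled_set n S =
    \bigcap_(x in [set` window d n]) [set w : config d.+2 | w x = filled n S x].
  by apply/seteqP; split=> w h x xn; exact: h.
by apply: fin_bigcap_measurable => // x _; exact: measurable_site.
Qed.

(** Each particle on the diamond replaces a factor [1 - p] by [p]. *)
Lemma measure_filled n (S : {fset plane}) : {subset S <= diamond n} ->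
  mu (filled_set n S) = (background n * lam ^+ #|` S|)%:E.
Proof.
move=> Sn; have -> : filled_set n S = [set w : config d.+2 |
    forall x : window d n, w (val x) = [ffun x : window d n => filled n S (val x)] x].
  apply/seteqP; split=> w h; first by move=> x; rewrite ffunE; exact: (h _ (valP x)).
  by move=> x xn; have := h [` xn]%fset; rewrite ffunE.
rewrite mu_p; congr EFin; under eq_bigr do rewrite ffunE.
rewrite -(big_seq_fsetE _ _ predT (fun x => bernoulli_pmf p (filled n S x))) /=.
have pmfE x : bernoulli_pmf p (filled n S x) = bernoulli_pmf p (filled n fset0 x) *
    (if (diamond_dist n x == 0%N) && (planar x \in S) then lam else 1).
  rewrite /filled in_fset0 andbF orbF; case: ltnP => x1 /=.
    by rewrite gtn_eqF ?mulr1 //; lia.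
  case: ifP => _ /=; rewrite ?mulr1 // /lam mulrC divfK //.
  by rewrite gt_eqF // (pmf_gt0 false).
under eq_bigr do rewrite pmfE.
rewrite big_split /=; congr (_ * _); rewrite -big_mkcond -big_filter.
have fE : perm_eq [seq x <- window d n | (diamond_dist n x == 0%N) && (planar x \in S)]
                  [seq embed d a | a <- S].
  apply: uniq_perm; rewrite ?filter_uniq ?fset_uniq // ?map_inj_uniq ?fset_uniq //.
    by move=> a b /(congr1 (@planar d)); rewrite !planar_embed.
  move=> x; rewrite mem_filter mem_window; apply/andP/mapP => [[/andP[+ xS] _]|[a aS ->]].
    rewrite diamond_dist_eq0 => /andP[/eqP x0 _].
    by exists (planar x); rewrite ?embed_planar.
  have an : (norm1 a <= n)%N by rewrite -mem_diamond Sn.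
  by rewrite planar_embed diamond_dist_embed // eqxx.
rewrite (perm_big _ fE) big_map big_const_seq count_predT.
by elim: (size _) => //= k ->; rewrite exprS.
Qed.

Lemma filled_inj n (S S' : {fset plane}) w : {subset S <= diamond n} -> {subset S' <= diamond n} ->
  filled_event (d := d) n S w -> filled_event n S' w -> S = S'.
Proof.
move=> Sn S'n wS wS'; apply/fsetP => a; case: (boolP (norm1 a <= n)%N) => an.
  have := wS _ (embed_window d an); rewrite (wS' _ (embed_window d an)) /filled.
  by rewrite diamond_dist_embed // planar_embed.
have out (T : {fset plane}) : {subset T <= diamond n} -> (a \in T) = false.
  by move=> Tn; apply/negP => /Tn; rewrite mem_diamond (negbTE an).
by rewrite !out.
Qed.

Definition filled_in n (X : {fset {fset plane}}) : set (config d.+2) :=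
  \bigcup_(S in [set` X]) filled_set n S.

Lemma measurable_filled_in n X : measurable (filled_in n X).
Proof. by apply: fin_bigcup_measurable => // S _; exact: measurable_filled. Qed.

Lemma measure_filled_in n (X : {fset {fset plane}}) : (X `<=` fpowerset (diamond n))%fset ->
  mu (filled_in n X) = (background n * \sum_(S <- X) lam ^+ #|` S|)%:E.
Proof.
move=> /fsubsetP Xn.
have Xn' S : S \in X -> {subset S <= diamond n} by move=> /Xn; rewrite fpowersetE => /fsubsetP.
rewrite /filled_in bigcup_fset measure_fbigsetU.
- rewrite mulr_sumr -sumEFin big_seq [RHS]big_seq; apply: eq_bigr => S SX.
  by apply: measure_filled; exact: Xn'.
- by move=> S _; exact: measurable_filled.
- by move=> S S' SX S'X [w [wS wS']]; apply: (filled_inj _ _ wS wS'); exact: Xn'.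
Qed.

Definition walled_set n : set (config d.+2) := [set w | walled n (thin w)].
Definition walled_const n b : set (config d.+2) :=
  [set w | walled n (thin w) /\ forall x, x \in cross d -> thin w x = b].

Lemma measure_walled_empty n : (0 < n)%N ->
  mu (walled_const n false) = (background n * hardcore_sum lam n predT)%:E.
Proof.
move=> n0; pose X := [fset S in fpowerset (diamond n) | indep S]%fset.
have -> : walled_const n false = filled_in n X.
  apply/seteqP; split=> w.
    move=> /(walled_empty w n0)[S Sn [iS wS]]; exists S => //=.
    by rewrite !inE fpowersetE iS andbT; apply/fsubsetP.
  move=> [S /=]; rewrite !inE fpowersetE => /andP[/fsubsetP Sn iS] wS.
  by apply/(walled_empty w n0); exists S.
rewrite measure_filled_in; last by apply/fsubsetP => S; rewrite !inE => /andP[].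
congr (_ * _)%:E; rewrite /X big_fset /=.
by apply: eq_bigl => S; rewrite andbT.
Qed.

Lemma measure_walled_full n : (0 < n)%N ->
  mu (walled_const n true) = (background n * (lam * hardcore_sum lam n surrounded))%:E.
Proof.
move=> n0; pose Y := [fset S in fpowerset (diamond n) | indep S && surrounded S]%fset.
pose X := [fset (0 |` S)%fset | S in Y]%fset.
have n0S S : S \in Y -> 0 \notin S.
  rewrite !inE => /and3P[_ /indepP iS /allP sS]; apply/negP => S0.
  have eS : e1 \in S by apply: sS; rewrite mem_nbrs.
  by have := iS _ _ S0 eS.
have -> : walled_const n true = filled_in n X.
  apply/seteqP; split=> w.
    move=> /(walled_full w n0)[S Sn [iS sS wS]]; exists (0 |` S)%fset => //=.
    apply/imfsetP; exists S => //=; rewrite !inE fpowersetE iS sS !andbT.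
    exact/fsubsetP.
  move=> [_ /= /imfsetP[S /= + ->]]; rewrite !inE fpowersetE => /and3P[/fsubsetP Sn iS sS] wS.
  by apply/(walled_full w n0); exists S.
rewrite measure_filled_in; last first.
  apply/fsubsetP => _ /imfsetP[S /= + ->]; rewrite !inE !fpowersetE => /andP[/fsubsetP Sn _].
  by apply/fsubsetP => a; rewrite in_fset1U => /predU1P[->|/Sn //]; rewrite mem_diamond.
congr (_ * _)%:E; rewrite /X big_imfset /=; last first.
  move=> S S' SY S'Y E; apply/fsetP => a; have := congr1 (fun A : {fset plane} => a \in A) E.
  by rewrite !in_fset1U; case: eqVneq => // -> _; rewrite !(negbTE (n0S _ _)).
rewrite /hardcore_sum big_distrr /= /Y big_fset /=.
rewrite big_seq_cond [RHS]big_seq_cond.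
apply: eq_big => [//|S /andP[Sn SY]].
by rewrite cardfsU1 n0S ?exprS // !inE Sn SY.
Qed.

Lemma measure_walled_le n : (0 < n)%N -> measurable (walled_set n) ->
  (mu (walled_set n) <= (background n * (cross_weight lam * hardcore_sum lam n predT))%:E)%E.
Proof.
move=> n0 mW; pose X := [fset S in fpowerset (diamond n) | indep (S `\` diamond 1)]%fset.
apply: (@le_trans _ _ (mu (filled_in n X))).
  apply: le_measure; rewrite ?inE //; first exact: measurable_filled_in.
  move=> w /(walled_subset n0)[S Sn [iS wS]]; exists S => //=.
  by rewrite !inE fpowersetE iS andbT; apply/fsubsetP.
rewrite measure_filled_in; last by apply/fsubsetP => S; rewrite !inE => /andP[].
rewrite lee_fin ler_pM2l ?background_gt0 // /X big_fset /=.
exact: hardcore_sum_off_cross odds_gt0.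
Qed.

End Measure.

(** * Conditional probabilities from a specification *)

Section Specification.
Context {R : realType} {d : nat}.
Local Open Scope ereal_scope.

Definition agree_off (L : {fset site d}) (w w' : thinned d) : Prop :=
  forall x, x \notin L -> w x = w' x.

Lemma measurable_coordinate (x : site d) b : measurable [set s : thinned d | s x = b].
Proof. by apply: sub_sigma_algebra; exists x => //; exists [set b]; rewrite ?setTI. Qed.

(** The events that do not distinguish configurations which agree off [L] form a
    sigma-algebra containing the coordinate events outside [L]. *)
Lemma outside_event (L : {fset site d}) (B : set (thinned d)) (w w' : thinned d) :
  @measurable _ (thinned_outside L) B -> agree_off L w w' -> B w -> B w'.
Proof.
move=> mB; pose inv (C : set (thinned d)) :=
  forall w w' : thinned d, agree_off L w w' -> C w <-> C w'.
suff: inv B by move=> iB /iB [].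
move: B mB; apply: smallest_sub.
  split => [|A iA|A iA] //.
    by move=> u u' uu; split=> -[_ Au]; split=> // Au'; apply: Au; apply/(iA _ _ uu).
  by move=> u u' uu; split=> -[k _ Au]; exists k => //; apply/(iA k _ _ uu).
move=> _ [x /= xL [C _ <-]] u u' uu; rewrite !setTI /preimage /=.
by rewrite (uu x) //; apply/negP.
Qed.

Lemma kernel_outside (gamma : @thinned_kernels R d) L (A : set (thinned d)) (w w' : thinned d) :
  measurable A -> agree_off L w w' -> gamma L w A = gamma L w' A.
Proof.
move=> mA ww; have := @measurable_kernel _ _ _ _ _ (gamma L) A mA measurableT [set gamma L w A].
rewrite setTI => /(_ (emeasurable_set1 _)) mB.
by apply/esym; apply: (outside_event mB ww).
Qed.

Lemma measurable_kernel_thinned (gamma : @thinned_kernels R d) L (A : set (thinned d)) :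
  measurable A -> measurable_fun [set: thinned d] (fun w : thinned d => gamma L w A).
Proof.
move=> mA _ B mB; have := @measurable_kernel _ _ _ _ _ (gamma L) A mA measurableT B mB.
by apply: (@sub_sigma_algebra2 _ setT _ (coordinate_events (@thinned_val d) (~` [set` L])))
  => C [x _ xC]; exists x.
Qed.

Lemma kernel_fin (gamma : @thinned_kernels R d) L (A : set (thinned d)) (w : thinned d) :
  measurable A -> 0 <= gamma L w A <= 1.
Proof.
move=> mA; rewrite measure_ge0 /=.
have <- : gamma L w setT = 1 := prob_kernel (s := gamma L) w.
by apply: le_measure; rewrite ?inE.
Qed.

(** Under a proper kernel the configuration off [L] is that of [w] almost surely, so an
    event [E] that is decided off [L] has probability one or zero. *)
Lemma proper_restrict (gamma : @thinned_kernels R d) L (A E : set (thinned d)) (w : thinned d) :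
  Defs.proper gamma -> measurable A -> measurable E ->
  (forall s s', agree_off L s s' -> E s -> E s') ->
  gamma L w (A `&` E) = ((fun s : thinned d => gamma L s A) \_ E) w.
Proof.
move=> pg mA mE EL; pose G := [set s : thinned d | forall x, x \notin L -> s x = w x].
have mG : measurable G.
  (* the sites are countable: enumerate them through their codes *)
  pose C (i : nat) : set (thinned d) := if @choice.unpickle (site d) i is Some x
    then [set s : thinned d | x \notin L -> s x = w x] else setT.
  have -> : G = \bigcap_(i in setT) C i.
    apply/seteqP; split=> s Gs.
      by move=> i _; rewrite /C; case: (choice.unpickle i) => // x; exact: Gs.
    by move=> x xL; have := Gs (choice.pickle x) I; rewrite /C choice.pickleK; apply.
  apply: (@bigcap_measurableType _ (thinned d) C setT) => i _.
  rewrite /C; case: (choice.unpickle i) => // x.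
  case: (boolP (x \in L)) => xL; last first.
    rewrite (_ : mkset _ = [set s : thinned d | s x = w x]).
      exact: (measurable_coordinate x (w x)).
    by apply/seteqP; split=> s /= => [/(_ isT)|].
  by rewrite (_ : mkset _ = setT) //; apply/seteqP; split.
have gG : gamma L w G = 1 by exact: pg.
have gnG : gamma L w (~` G) = 0.
  have gT : gamma L w setT = 1 := prob_kernel (s := gamma L) w.
  have : 1 = gamma L w (~` G) + gamma L w G.
    have := measureDI (gamma L w) (@measurableT _ (thinned d)) mG.
    by rewrite setTD setTI => <-; apply/esym.
  by rewrite gG => /(congr1 (fun x => x - 1)); rewrite addeK // => <-; rewrite subee.
have gC (H : set (thinned d)) : measurable H -> H `<=` ~` G -> gamma L w H = 0.
  by move=> mH GH; apply: (subset_measure0 mH (measurableC mG) GH).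
rewrite /patch; case: ifPn => [/set_mem Ew|/negP nEw].
  have DI : gamma L w A = gamma L w (A `\` E) + gamma L w (A `&` E) by exact: measureDI.
  rewrite /= DI [X in X + _]gC ?add0e //; first exact: measurableD.
  by move=> s [_ nEs] Gs; apply/nEs/(EL w) => // x xL; rewrite Gs.
transitivity (0 : \bar R) => //; apply: gC; first exact: measurableI.
by move=> s [_ Es] Gs; apply/nEw/mem_set/(EL s) => // x xL; rewrite Gs.
Qed.

(** Conditionally on an event decided off [L], the probability of [A] is an average of
    the values of the kernel over this event. *)
Lemma kernel_mean (gamma : @thinned_kernels R d) L (mu : probability (thinned d) R)
    (A E : set (thinned d)) (a b : R) :
  Defs.proper gamma -> specification_for gamma mu -> measurable A -> measurable E ->
  (forall s s', agree_off L s s' -> E s -> E s') ->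
  (0 <= b)%R -> (forall s, E s -> a%:E <= gamma L s A <= b%:E) ->
  a%:E * mu E <= mu (A `&` E) <= b%:E * mu E.
Proof.
move=> pg dlr mA mE EL b0 gab; rewrite -(dlr L (A `&` E)); last exact: measurableI.
have -> : \int[mu]_s gamma L s (A `&` E) = \int[mu]_(s in E) gamma L s A.
  rewrite [RHS]integral_mkcond; apply: eq_integral => s _.
  exact: proper_restrict.
have mg : measurable_fun E (fun s : thinned d => gamma L s A).
  by apply: measurable_funTS; exact: measurable_kernel_thinned.
apply/andP; split; last first.
  rewrite -(integral_cst mu mE); apply: ge0_le_integral => //=.
  by move=> s /gab /andP[].
have [a0|a0] := leP 0%R a.
  rewrite -(integral_cst mu mE); apply: ge0_le_integral => //=.
  by move=> s /gab /andP[].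
apply: (@le_trans _ _ 0); last by apply: integral_ge0.
by rewrite mule_le0_ge0 // ?lee_fin ltW.
Qed.

End Specification.

(** * Pointwise convergence of image configurations *)

Lemma thinned_cvg d (s : nat -> thinned d) (l : thinned d) :
  (forall x, \forall n \near \oo, s n x = l x) -> s n @[n --> \oo] --> l.
Proof.
move=> sl.
have cv : (fun n => sval (s n) : config d) @ \oo --> (sval l : config d).
  apply/cvg_sup. move=> x U [_ [[B oB <-] Bl BU]].
  have := sl x; apply: filterS => n sn; apply: BU.
  by rewrite /preimage /=; move: sn; rewrite /thinned_val => ->.
move=> U [_ [[B oB <-] Bl BU]].
have nB : nbhs (sval l : config d) B by apply: open_nbhs_nbhs; split.
have cB : \forall n \near \oo, B (sval (s n)) := cv B nB.
have : \forall n \near \oo, U (s n) by apply: filterS cB => n; exact: BU.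
exact.
Qed.

(** * Continuity at the slab configuration *)

Lemma thin_fixed d (f : config d) :
  (forall x, f x -> exists2 y, y \in neighbours x & f y) -> thin f = f.
Proof.
move=> fn; apply/funext => x; rewrite thinE; case: (boolP (f x)) => //= fx.
by have [y yx fy] := fn x fx; apply/hasP; exists y.
Qed.

(** A particle that survives the thinning keeps alive the neighbour that saved it. *)
Lemma thinned_neighbour d (s : thinned d) x : s x ->
  exists2 y, y \in neighbours x & s y.
Proof.
case: s => w ws; have [v _ vw] := set_mem ws; rewrite /thinned_val /= -vw.
rewrite thinE => /andP[vx /hasP[y yx vy]]; exists y => //.
rewrite thinE vy /=; apply/hasP; exists x => //.
move/allpairsP: yx => [[k t] /= [_ tt ->]]; apply/allpairsP.
exists (k, - t); rewrite mem_enum /= scaleNr addrK; split=> //.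
by move: tt; rewrite !inE eqr_oppLR => /orP[/eqP->|/eqP->]; rewrite ?opprK eqxx ?orbT.
Qed.

Section Limit.
Context {R : realType} {d : nat}.
Notation site := (site d.+2).

(** The configuration at which quasilocality fails. *)
Definition slab : config d.+2 := fun x => (2 <= height x)%N.

Lemma thin_slab : thin slab = slab.
Proof.
apply: thin_fixed => x sx; have [b xb _] := norm1_up (planar x).
have [y [yx _ hy]] := plane_neighbour xb.
by exists y; rewrite // /slab hy.
Qed.

Definition bad_config : thinned d.+2 := to_thinned slab.

Lemma bad_configE x : bad_config x = (2 <= height x)%N.
Proof. by rewrite /thinned_val /= thin_slab. Qed.

(** The neighbours of the cross are vacant or in the cross, so erasing the cross leaves
    no isolated site behind. *)
Lemma erase_cross n (s : thinned d.+2) : (0 < n)%N -> walled n s ->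
  exists2 s' : thinned d.+2, agree_off (cross d) s s' &
    forall x, x \in window d n -> s' x = (2 <= diamond_dist n x)%N.
Proof.
move=> n0 sn; pose f : config d.+2 := fun x => (x \notin cross d) && s x.
have thinf : thin f = f.
  apply: thin_fixed => x /andP[xL sx]; have [y yx sy] := thinned_neighbour sx.
  exists y => //; rewrite /f sy andbT; apply/negP; rewrite mem_cross => /andP[/eqP hy py].
  have y0 : diamond_dist n y = 0%N by apply/eqP; rewrite diamond_dist_eq0 hy; lia.
  have x1 : (diamond_dist n x <= 1)%N.
    by rewrite neighbours_sym in yx; have := diamond_dist_neighbour n yx; rewrite y0.
  move: sx; rewrite sn // ?mem_window; lia.
exists (to_thinned f) => x; rewrite /thinned_val /= thinf /f.
  by move=> ->.
case: (boolP (x \in cross d)) => [|xL] xn /=; last exact: sn.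
rewrite mem_cross in xn * => xw; move: xn => /andP[/eqP hx px].
by rewrite (_ : diamond_dist n x = 0%N) //; apply/eqP; rewrite diamond_dist_eq0 hx; lia.
Qed.

(** Otherwise a sequence of walled configurations for growing diamonds would violate
    the bounds. Erasing the cross does not affect the kernel and makes the sequence
    converge to the slab configuration, against continuity there. *)
Lemma walled_limit (gamma : @thinned_kernels R d.+2) (eta : {ffun cross d -> bool}) (e : R) :
  let A := [set s : thinned d.+2 | forall x : cross d, s (val x) = eta x] in
  let c := fine (gamma (cross d) bad_config A) in
  quasilocal gamma -> measurable A -> 0 < e ->
  exists N, forall n, (N <= n)%N -> forall s : thinned d.+2, walled n s ->
    ((c - e)%:E <= gamma (cross d) s A <= (c + e)%:E)%E.
Proof.
move=> A c ql mA e0; apply: contrapT => noN.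
(* The counterexample for k, with its cross already erased. *)
pose bad k (v : thinned d.+2) := exists n, [/\ (k <= n)%N,
    (0 < n)%N, forall x, x \in window d n -> v x = (2 <= diamond_dist n x)%N &
    ~ ((c - e)%:E <= gamma (cross d) v A <= (c + e)%:E)%E].
have /boolp.choice[u uP] : forall k, exists v, bad k v.
  move=> k; apply: contrapT => nok; apply: noN.
  exists k.+1 => n kn s sn; apply: contrapT => nb; apply: nok.
  have n0 : (0 < n)%N by lia.
  have [s' ss' s'n] := erase_cross n0 sn.
  exists s', n; split=> //; first lia.
  by rewrite -(kernel_outside gamma mA ss').
have u_bad : u k @[k --> \oo] --> bad_config.
  apply: thinned_cvg => x; exists (norm1 (planar x) + height x)%N => // k kx; rewrite /= in kx.
  have [n [kn n0 un _]] := uP k; rewrite [RHS]bad_configE.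
  have nx : (norm1 (planar x) <= n)%N by lia.
  have nh : (height x <= n)%N by lia.
  have fx : diamond_dist n x = height x by rewrite /diamond_dist; lia.
  by rewrite un ?mem_window fx //; lia.
have gcvg : gamma (cross d) (u k) A @[k --> \oo] --> gamma (cross d) bad_config A.
  exact: (cvg_comp _ _ u_bad (ql (cross d) eta bad_config)).
have cE : gamma (cross d) bad_config A = c%:E.
  have /andP[g0 g1] := kernel_fin gamma (cross d) bad_config mA.
  by rewrite /c fineK // ge0_fin_numE // (le_lt_trans g1) // ltey.
rewrite cE in gcvg.
have near1 : \forall k \near \oo, ((c - e)%:E < gamma (cross d) (u k) A)%E.
  apply: (gcvg [set y | ((c - e)%:E < y)%E]); apply: open_nbhs_nbhs.
  by split; [exact: open_ereal_gt_ereal|rewrite /= lte_fin ltrBlDr ltrDl].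
have near2 : \forall k \near \oo, (gamma (cross d) (u k) A < (c + e)%:E)%E.
  apply: (gcvg [set y | (y < (c + e)%:E)%E]); apply: open_nbhs_nbhs.
  by split; [exact: open_ereal_lt_ereal|rewrite /= lte_fin ltrDl].
have [k [k1 k2]] : exists k, ((c - e)%:E < gamma (cross d) (u k) A)%E /\
    (gamma (cross d) (u k) A < (c + e)%:E)%E.
  have [k [k1 k2]] := filter_ex (filterI near1 near2).
  by exists k.
have [n [_ _ _]] := uP k; apply.
by rewrite !ltW.
Qed.

End Limit.

(** * The contradiction *)

(** The arithmetic of the contradiction: [z / e] and [lam * y / e] are conditional
    probabilities for one parity, [z' / e'] and [lam * y' / e'] for the other. Both
    pairs are within [eps] of [(c0, c1)], and [c0] is bounded below by about [1 / M],
    but [y / z] is at most 1/4 and [y' / z'] at least 3/4. *)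
Lemma phase_gap (R : realFieldType) (lam M c0 c1 eps : R) (z y e z' y' e' : R) :
  0 < lam -> 0 < M -> 0 < eps -> 2 * M * (2 * lam + 3) * eps = lam ->
  0 < e -> 0 < e' -> e <= M * z ->
  z <= (c0 + eps) * e -> (c0 - eps) * e' <= z' ->
  (c1 - eps) * e <= lam * y -> lam * y' <= (c1 + eps) * e' ->
  4 * y <= z -> 3 * z' <= 4 * y' -> False.
Proof.
move=> lam0 M0 eps0 Heps e0 e'0 eM ze z'e' ye y'e' yz z'y'.
have h1 : 1 <= M * (c0 + eps).
  rewrite -(ler_pM2r e0) mul1r -mulrA; apply: le_trans eM _.
  by rewrite ler_pM2l.
have h2 : 4 * (c1 - eps) <= lam * (c0 + eps).
  rewrite -(ler_pM2r e0) -!mulrA; apply: (@le_trans _ _ (lam * z)); last by rewrite ler_pM2l.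
  apply: (@le_trans _ _ (lam * (4 * y))); last by rewrite ler_pM2l.
  by rewrite [X in _ <= X]mulrCA ler_pM2l.
have h3 : 3 * (lam * (c0 - eps)) <= 4 * (c1 + eps).
  rewrite -(ler_pM2r e'0) -!mulrA; apply: (@le_trans _ _ (lam * (3 * z'))).
    by rewrite mulrCA !ler_pM2l.
  apply: (@le_trans _ _ (lam * (4 * y'))); first by rewrite ler_pM2l.
  by rewrite mulrCA ler_pM2l.
have h4 : 2 * lam * c0 <= (4 * lam + 8) * eps by lra.
have h5 : M * (2 * lam * c0) <= M * ((4 * lam + 8) * eps) by rewrite ler_pM2l.
have h6 : 2 * lam * 1 <= 2 * lam * (M * (c0 + eps)) by rewrite ler_pM2l // mulr_gt0.
have h7 : 0 < M * eps by rewrite mulr_gt0.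
have h8 : 0 < lam * (M * eps) by rewrite mulr_gt0.
lra.
Qed.

Section Main.
Context {R : realType} {d : nat}.
Variables (p : R) (mu : probability (config d.+2) R).
Hypotheses (p01 : 0 < p < 1) (mu_p : bernoulli_field p mu).

Let lam : R := p / (1 - p).
Let mu' := distribution mu (@to_thinned d.+2).

Definition walled_event n : set (thinned d.+2) := [set s | walled n s].
Definition cross_event (b : bool) : set (thinned d.+2) :=
  [set s | forall x : cross d, s (val x) = [ffun=> b] x].

Lemma measurable_walled n : measurable (walled_event n).
Proof.
have -> : walled_event n = \bigcap_(x in [set` window d n])
    [set s : thinned d.+2 | x \notin cross d -> s x = (2 <= diamond_dist n x)%N].
  by apply/seteqP; split=> s h x => [xn xL|xL xn]; exact: h.
apply: fin_bigcap_measurable => // x _; case: (boolP (x \in cross d)) => xL; last first.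
  rewrite (_ : mkset _ = [set s : thinned d.+2 | s x = (2 <= diamond_dist n x)%N]).
    exact: (measurable_coordinate x).
  by apply/seteqP; split=> s /= => [/(_ isT)|].
by rewrite (_ : mkset _ = setT) //; apply/seteqP; split.
Qed.

Lemma measurable_cross b : measurable (cross_event b).
Proof.
have -> : cross_event b = \bigcap_(x in [set` cross d]) [set s : thinned d.+2 | s x = b].
  apply/seteqP; split=> s h x; first by move=> xL; have := h [` xL]%fset; rewrite ffunE.
  by rewrite ffunE; exact: (h _ (valP x)).
by apply: fin_bigcap_measurable => // x _; exact: (measurable_coordinate x b).
Qed.

Lemma preimage_walled n : @to_thinned d.+2 @^-1` walled_event n = walled_set n.
Proof. by []. Qed.

Lemma preimage_cross n b :
  @to_thinned d.+2 @^-1` (cross_event b `&` walled_event n) = walled_const n b.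
Proof.
apply/seteqP; split=> w [h1 h2]; split=> //.
  by move=> x xL; have := h1 [` xL]%fset; rewrite ffunE.
by move=> x; rewrite ffunE; exact: (h2 _ (valP x)).
Qed.

(** Radii of both parities are compared: the conditional probabilities of an empty and
    of a full cross converge along all radii, whereas their ratio is [lam] times the
    probability that the origin is surrounded, which alternates. *)
Lemma no_quasilocal_specification (gamma : @thinned_kernels R d.+2) :
  phase_threshold R <= lam ->
  specification gamma -> quasilocal gamma -> ~ specification_for gamma mu'.
Proof.
move=> lamT [pg _] ql dlr; have lam0 : 0 < lam := odds_gt0 p01.
pose M := cross_weight lam.
pose c b := fine (gamma (cross d) (bad_config (d := d)) (cross_event b)).
have c_ge0 b : 0 <= c b by apply: fine_ge0.
pose ew n := fine (mu' (walled_event n)).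
have ewE n : mu' (walled_event n) = (ew n)%:E.
  by rewrite /ew fineK // fin_num_measure //; exact: measurable_walled.
pose z n := background (d := d) p n * hardcore_sum lam n predT.
pose y n := background (d := d) p n * hardcore_sum lam n surrounded.
have z_gt0 n : 0 < z n by rewrite mulr_gt0 ?background_gt0 ?hardcore_sum_gt0.
have zE n : (0 < n)%N -> mu' (cross_event false `&` walled_event n) = (z n)%:E.
  move=> n0; rewrite -(measure_walled_empty p01 mu_p n0) -preimage_cross //.
have yE n : (0 < n)%N -> mu' (cross_event true `&` walled_event n) = (lam * y n)%:E.
  by move=> n0; rewrite /y mulrCA -(measure_walled_full p01 mu_p n0) -preimage_cross.
have ze n : (0 < n)%N -> z n <= ew n.
  move=> n0; rewrite -lee_fin -zE // -ewE; apply: le_measure; rewrite ?inE.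
  - by apply: measurableI; [exact: measurable_cross|exact: measurable_walled].
  - exact: measurable_walled.
  - by move=> s [].
have eM n : (0 < n)%N -> ew n <= M * z n.
  move=> n0; rewrite -lee_fin -ewE.
  have mW : measurable (walled_set (d := d) n).
    rewrite -preimage_walled -[X in measurable X]setTI.
    exact: (@measurable_to_thinned d.+2 measurableT _ (measurable_walled n)).
  have := measure_walled_le p01 mu_p n0 mW.
  by rewrite /z /M mulrCA -preimage_walled.
have M_gt0 : 0 < M.
  have := le_trans (ze 1%N isT) (eM 1%N isT); have := z_gt0 1%N => z1.
  by rewrite -{1}(mul1r (z _)) ler_pM2r // => /(lt_le_trans ltr01).
(* The tolerance required by phase_gap. *)
pose eps := lam / (2 * M * (2 * lam + 3)).
have D_gt0 : 0 < 2 * M * (2 * lam + 3) by rewrite !mulr_gt0 // addr_gt0 // mulr_gt0.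
have eps_gt0 : 0 < eps by rewrite divr_gt0.
have bounds b : exists N, forall n, (N <= n)%N ->
    (((c b - eps) * ew n)%:E <= mu' (cross_event b `&` walled_event n) <=
     ((c b + eps) * ew n)%:E)%E.
  have [N HN] := walled_limit ql (measurable_cross b) eps_gt0.
  exists N => n Nn; rewrite !EFinM -ewE.
  apply: (kernel_mean pg dlr (measurable_cross b) (measurable_walled n)).
  - by move=> s s' ss sn x xL xn; rewrite -(ss x xL); exact: sn.
  - by rewrite addr_ge0 // ltW.
  - by move=> s sn; exact: (HN n Nn s sn).
have [N0 H0] := bounds false; have [N1 H1] := bounds true.
(* The radii n and n + 1 have different parities. *)
pose n := (2 * (N0 + N1).+1)%N.
have [n0 m0] : (0 < n)%N /\ (0 < n.+1)%N by rewrite /n; lia.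
have /andP[_ zn] : (c false - eps) * ew n <= z n <= (c false + eps) * ew n.
  rewrite -!lee_fin -zE //; apply: H0; rewrite /n; lia.
have /andP[zm _] : (c false - eps) * ew n.+1 <= z n.+1 <= (c false + eps) * ew n.+1.
  rewrite -!lee_fin -zE //; apply: H0; rewrite /n; lia.
have /andP[yn _] : (c true - eps) * ew n <= lam * y n <= (c true + eps) * ew n.
  by rewrite -!lee_fin -yE //; apply: H1; rewrite /n; lia.
have /andP[_ ym] : (c true - eps) * ew n.+1 <= lam * y n.+1 <= (c true + eps) * ew n.+1.
  by rewrite -!lee_fin -yE //; apply: H1; rewrite /n; lia.
have ew_gt0 k : (0 < k)%N -> 0 < ew k by move=> k0; apply: lt_le_trans (ze k k0).
apply: (@phase_gap _ lam M (c false) (c true) eps _ _ _ _ _ _ _ _ _ _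
  (ew_gt0 n n0) (ew_gt0 n.+1 m0) (eM n n0) zn zm yn ym) => //.
- by rewrite /eps mulrC divfK // gt_eqF.
- rewrite /y /z mulrCA ler_pM2l ?background_gt0 //.
  by apply: surrounded_rare; rewrite // /n oddM.
- rewrite /y /z mulrCA [X in _ <= X]mulrCA ler_pM2l ?background_gt0 //.
  by apply: surrounded_likely; rewrite // /n oddS oddM.
Qed.

End Main.

Lemma phase_threshold_gt0 (R : realFieldType) : 0 < phase_threshold R.
Proof. by rewrite /phase_threshold mulr_gt0 // addr_gt0 // !mulr_gt0 // exprn_gt0. Qed.

Theorem theorem2p1 (R : realType) (d : nat) (hd : (2 <= d)%N) :
  exists pc : R, 0 <= pc < 1 /\
    forall p : R, pc < p < 1 ->
    forall mu : probability (config d) R, bernoulli_field p mu ->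
      ~ exists gamma : @thinned_kernels R d,
          [/\ specification gamma, quasilocal gamma &
              specification_for gamma (distribution mu (@to_thinned d))].
Proof.
case: d hd => [|[|d]] // _; set T := phase_threshold R.
have T0 : 0 < T := phase_threshold_gt0 R.
have T1 : 0 < 1 + T by rewrite addr_gt0.
exists (T / (1 + T)); split.
  by rewrite divr_ge0 ?ltW //= ltr_pdivrMr // mul1r ltrDr.
move=> p /andP[pcp p1] mu mu_p [gamma [sg qg dg]].
have p01 : 0 < p < 1 by rewrite p1 (lt_trans _ pcp) // divr_gt0.
apply: (no_quasilocal_specification p01 mu_p _ sg qg dg).
rewrite ler_pdivlMr ?subr_gt0 //; move: pcp; rewrite ltr_pdivrMr // -/T; nra.
Qed.
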